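(* Let $\Gamma$ be a uniformly random labeled $\mathrm{PSL}_2(\mathbb Z)$-cyclically reduced graph of size $n$. Then the average number of vertices of $\mathrm{silh}(\Gamma)$ is greater than $n-2n^{\frac23}+o(n^{\frac23})$. Moreover, for every $\mu>0$ there exists $0<\gamma<1$ such that the probability that $\mathrm{silh}(\Gamma)$ has less than $n-(2+\mu)n^{\frac23}$ vertices is $O(\gamma^{n^{1/3}})$.
   Context: A $\mathrm{PSL}_2(\mathbb Z)$-cyclically reduced graph is a finite connected graph with undirected $a$-edges and directed $b$-edges such that: every vertex lies on exactly one $a$-edge, which is either an $a$-loop or an isolated $a$-edge (joining two distinct vertices); the $b$-edges form a partial injective map on vertices, every vertex lies on a $b$-edge, and each $b$-edge is a $b$-loop, or an isolated $b$-edge (joining two distinct vertices lying on no other $b$-edge), or one of the edges of a $b$-triangle (a directed 3-cycle on three distinct vertices). Its size is its number of vertices. It is labeled if its vertex set of size $n$ is $\{1,\dots,n\}$; ''random'' refers to the uniform distribution on labeled graphs of size $n$. Special graphs: $\Delta_1$ has one vertex carrying an $a$-loop and a $b$-loop; $\Delta_2$ has two vertices joined by an isolated $a$-edge and by an isolated $b$-edge; $\Delta_3$ has two vertices joined by an isolated $b$-edge, each carrying an $a$-loop. Moves on a cyclically reduced graph (deleting a vertex also deletes its adjacent edges): - $\lambda_3$: if $v$ carries a $b$-loop and an isolated $a$-edge joins $v$ to $w\ne v$, delete $v$ and add an $a$-loop at $w$. - $\lambda_{2,1}$: if $v$ carries an $a$-loop and lies on a $b$-triangle $w\to v\to w'\to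 w$, delete $v$ (the $b$-edge $w'\to w$ becomes isolated). - $\lambda_{2,2}$: if $v$ carries an $a$-loop, an isolated $b$-edge (of either orientation) joins $v$ and $w\ne v$, and an isolated $a$-edge joins $w$ to $w'\notin\{v,w\}$, delete $v$ and $w$ and add an $a$-loop at $w'$. - $\kappa_3$: if there is an isolated $b$-edge $v\to w$, and isolated $a$-edges join $v$ to $v'$ and $w$ to $w'$ with $v,w,v',w'$ pairwise distinct, delete $v$ and $w$ and add an isolated $a$-edge between $v'$ and $w'$. - $\mathrm{exc}$: if the graph is $\Delta_3$ with $b$-edge $v\to w$, replace it by $\Delta_1$ with vertex $v$. The silhouette $\mathrm{silh}(\Gamma)$ is the graph obtained by applying a maximal sequence of moves to $\Gamma$ (then relabeling vertices in an order-preserving way by $1,\dots,s$); in particular its number of vertices does not depend on the sequence chosen. It is either $\Delta_1$, or $\Delta_2$, or a graph with no loops and no isolated $b$-edges. *)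

(* Defs.v *)
From HB Require Import structures.
From mathcomp Require Import all_boot all_order all_algebra.

Set Implicit Arguments.
Unset Strict Implicit.
Unset Printing Implicit Defensive.

Local Open Scope nat_scope.

(* Graphs live inside an ambient finite type T, so that deleting vertices does
   not change the type.  An undirected a-edge is the set of its endpoints
   ([set v] is an a-loop at v); the pair (v, w) is a b-edge from v to w. *)
Record graph (T : finType) := Graph {
  vertices : {set T};
  aedges : {set {set T}};
  bedges : {set T * T}
}.

Definition graph_to_prod (T : finType) (G : graph T) :=
  (vertices G, aedges G, bedges G).
Definition prod_to_graph (T : finType)
    (p : {set T} * {set {set T}} * {set T * T}) :=
  Graph p.1.1 p.1.2 p.2.

Lemma graph_to_prodK (T : finType) :
  cancel (@graph_to_prod T) (@prod_to_graph T).
Proof. by case. Qed.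

HB.instance Definition _ (T : finType) :=
  Finite.copy (graph T) (can_type (@graph_to_prodK T)).

Section Graphs.
Variable T : finType.
Implicit Types (G H : graph T) (v w x : T).

Definition aloop G v : bool := [set v] \in aedges G.

(* When every vertex lies on exactly one a-edge, an a-edge with two distinct
   endpoints is automatically isolated. *)
Definition isolated_aedge G v w : bool :=
  (v != w) && ([set v; w] \in aedges G).

Definition bloop G v : bool := (v, v) \in bedges G.

Definition isolated_bedge G v w : bool :=
  [&& v != w, (v, w) \in bedges G &
      [forall p in bedges G,
         ((p.1 \in [set v; w]) || (p.2 \in [set v; w])) ==> (p == (v, w))]].

Definition btriangle G v w x : bool :=
  [&& uniq [:: v; w; x], (v, w) \in bedges G, (w, x) \in bedges G
    & (x, v) \in bedges G].

Definition well_formed G : bool :=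
  [forall e in aedges G, (e \subset vertices G) && (0 < #|e| <= 2)] &&
  [forall p in bedges G, (p.1 \in vertices G) && (p.2 \in vertices G)].

Definition adjacent G v w : bool :=
  [|| [set v; w] \in aedges G, (v, w) \in bedges G | (w, v) \in bedges G].

Definition connected_graph G : bool :=
  (vertices G != set0) &&
  [forall v in vertices G, forall w in vertices G, connect (adjacent G) v w].

Definition a_condition G : bool :=
  [forall v in vertices G, #|[set e in aedges G | v \in e]| == 1].

Definition partial_injective G : bool :=
  [forall p in bedges G, forall q in bedges G,
     ((p.1 == q.1) ==> (p.2 == q.2)) && ((p.2 == q.2) ==> (p.1 == q.1))].

Definition b_condition G : bool :=
  [&& partial_injective G,
      [forall v in vertices G, exists p in bedges G, (p.1 == v) || (p.2 == v)]
    & [forall p in bedges G,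
         [|| p.1 == p.2, isolated_bedge G p.1 p.2
           | [exists x, btriangle G p.1 p.2 x]]]].

Definition cyclically_reduced G : bool :=
  [&& well_formed G, connected_graph G, a_condition G & b_condition G].

Definition delete (D : {set T}) G : graph T :=
  Graph (vertices G :\: D)
        [set e in aedges G | [disjoint e & D]]
        [set p in bedges G | (p.1 \notin D) && (p.2 \notin D)].

Definition add_aedge (e : {set T}) G : graph T :=
  Graph (vertices G) (e |: aedges G) (bedges G).

(* Delta_1 with vertex v, and Delta_3 with b-edge v -> w *)
Definition Delta1 v : graph T := Graph [set v] [set [set v]] [set (v, v)].
Definition Delta3 v w : graph T :=
  Graph [set v; w] [set [set v]; [set w]] [set (v, w)].

Definition lambda3 G H : bool :=
  [exists v in vertices G, exists w,
    [&& bloop G v, isolated_aedge G v w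
      & H == add_aedge [set w] (delete [set v] G)]].

Definition lambda21 G H : bool :=
  [exists v in vertices G, exists w, exists w',
    [&& aloop G v, btriangle G w v w' & H == delete [set v] G]].

Definition lambda22 G H : bool :=
  [exists v in vertices G, exists w, exists w',
    [&& aloop G v, isolated_bedge G v w || isolated_bedge G w v,
        isolated_aedge G w w', w' \notin [set v; w]
      & H == add_aedge [set w'] (delete [set v; w] G)]].

Definition kappa3 G H : bool :=
  [exists v in vertices G, exists w, exists v', exists w',
    [&& isolated_bedge G v w, isolated_aedge G v v', isolated_aedge G w w',
        uniq [:: v; w; v'; w']
      & H == add_aedge [set v'; w'] (delete [set v; w] G)]].

Definition exc G H : bool :=
  [exists v, exists w, [&& v != w, G == Delta3 v w & H == Delta1 v]].

(* Only applied to cyclically reduced graphs, a class which moves preserve. *)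
Definition move : rel (graph T) := fun G H =>
  [|| lambda3 G H, lambda21 G H, lambda22 G H, kappa3 G H | exc G H].

(* H is the result of a maximal sequence of moves starting at G. *)
Definition is_reduct G H : bool :=
  connect move G H && [forall K, ~~ move H K].

Lemma move_decreases G H : move G H -> #|vertices H| < #|vertices G|.
Proof.
have del (D : {set T}) v : v \in vertices G -> v \in D ->
    #|vertices G :\: D| < #|vertices G|.
  move=> vG vD; apply: proper_card; apply/properP; split; first exact: subsetDl.
  by exists v => //; rewrite in_setD vD.
case/or4P => [||| /orP[]].
- case/exists_inP=> v vG /existsP[w /and3P[_ _ /eqP->]].
  by apply: (del _ v) => //; rewrite in_set1.
- case/exists_inP=> v vG /existsP[w /existsP[w' /and3P[_ _ /eqP->]]].
  by apply: (del _ v) => //; rewrite in_set1.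
- case/exists_inP=> v vG /existsP[w /existsP[w' /and5P[_ _ _ _ /eqP->]]].
  by apply: (del _ v) => //; rewrite in_set2 eqxx.
- case/exists_inP=> v vG /existsP[w /existsP[v' /existsP[w']]].
  case/and5P=> _ _ _ _ /eqP->.
  by apply: (del _ v) => //; rewrite in_set2 eqxx.
- case/existsP=> v /existsP[w /and3P[vw /eqP-> /eqP->]] /=.
  by rewrite cards1 cards2 vw.
Qed.

Lemma reduct_exists G : exists H, is_reduct G H.
Proof.
have [n] := ubnP #|vertices G|; elim: n G => // n IHn G leGn.
have [stuck|] := boolP [forall K, ~~ move G K].
  by exists G; rewrite /is_reduct connect0.
rewrite negb_forall => /existsP[K]; rewrite negbK => GK.
have [|H /andP[KH stuckH]] := IHn K.
  exact: leq_trans (move_decreases GK) leGn.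
by exists H; rewrite /is_reduct stuckH (connect_trans (connect1 GK)).
Qed.

(* An arbitrary maximal sequence of moves is chosen; the number of vertices of
   its endpoint does not depend on the choice when G is cyclically reduced. *)
Definition reduct G : graph T := xchoose (reduct_exists G).

Lemma reductP G : is_reduct G (reduct G).
Proof. exact: xchooseP. Qed.

End Graphs.

(* For T = 'I_n, enum_val enumerates the vertices in increasing order. *)
Definition relabel (T : finType) (G : graph T) : graph 'I_#|vertices G| :=
  let f := fun i : 'I_#|vertices G| => enum_val i in
  Graph [set: 'I_#|vertices G|]
        [set e : {set 'I_#|vertices G|} | f @: e \in aedges G]
        [set p | (f p.1, f p.2) \in bedges G].

Definition silh (n : nat) (G : graph 'I_n) : {s : nat & graph 'I_s} :=
  existT (fun s => graph 'I_s) #|vertices (reduct G)| (relabel (reduct G)).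

Definition silh_size (n : nat) (G : graph 'I_n) : nat :=
  #|vertices (tagged (silh G))|.

(* The vertex set {1, ..., n} is represented by 'I_n = {0, ..., n-1}. *)
Definition labeled_graphs (n : nat) : {set graph 'I_n} :=
  [set G | (vertices G == [set: 'I_n]) && cyclically_reduced G].

From mathcomp Require Import all_classical all_reals all_analysis.

Import Order.TTheory GRing.Theory Num.Theory.
Import numFieldNormedType.Exports.

Local Open Scope ring_scope.

Definition unif_mean (R : realType) (U : finType) (A : {set U}) (f : U -> R)
    : R :=
  (\sum_(x in A) f x) / #|A|%:R.

Definition unif_prob (R : realType) (U : finType) (A : {set U}) (P : pred U)
    : R :=
  #|[set x in A | P x]|%:R / #|A|%:R.

Definition mean_silh_size (R : realType) (n : nat) : R :=
  unif_mean (labeled_graphs n) (fun G => (silh_size G)%:R).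

Definition prob_silh_size_lt (R : realType) (n : nat) (t : R) : R :=
  unif_prob R (labeled_graphs n) (fun G => (silh_size G)%:R < t).

(* Main.v *)
Require Import Defs.
From HB Require Import structures.
From mathcomp Require Import all_boot all_order all_algebra.
From mathcomp Require Import zify ring lra.

(** Weigh a graph by X = 2 k3 + 3 l2 + 4 l3, where k3, l2, l3 count isolated
    b-edges, a-loops and b-loops.  A move that deletes d vertices decreases X by
    at least d, so the silhouette has at least n - X vertices, and it suffices
    to control X.

    Drop connectedness: a graph is then a pair of independent structures, each
    a partition of the vertices into pieces.  With A_n, B_n the numbers of a-
    and b-structures, deleting pieces gives the factorial moments of k3, l2, l3
    as products of the ratios tau_n = n A_{n-1} / A_n and n B_{n-1} / B_n, and
    the variance inequality for the number of loops gives
    tau_n <= tau_{n-1} + 1.  Fed into the linear recurrences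
    A_n = A_{n-1} + (n-1) A_{n-2} and
    B_n = B_{n-1} + 2(n-1) B_{n-2} + (n-1)(n-2) B_{n-3}, this yields
    tau_n ~ n^(1/2) and tau_n ~ n^(1/3) respectively.  The dominant term of X is
    2 k3, of mean about 2 n^(2/3), and Markov's inequality for the factorial
    moment of order about n^(1/3) gives the tail bound.

    Finally almost all pairs are connected: with u_n = A_n B_n / n!, the
    disconnected ones number at most n! times the sum of u_k u_{n-k} over
    0 < k < n, and u_n / u_{n-1} ~ n^(1/6) makes this sum o(u_n). *)

Set Implicit Arguments.
Unset Strict Implicit.
Unset Printing Implicit Defensive.

(** * Exact covers *)

Section ExactCovers.
Variables (T X : finType) (D : X -> {set T}) (K : {set X}).
Implicit Types (S : {set T}) (P Q L : {set X}) (v : T) (x y : X).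
Hypothesis D_neq0 : forall x, x \in K -> D x != set0.

(** [D x] is the vertex set of the piece [x]. Pieces are kept apart from their vertex sets because
    several b-pieces can share one, for instance the two orientations of an edge. *)
Definition exact_covers (S : {set T}) : {set {set X}} :=
  [set P : {set X} | [&& P \subset K, [forall x in P, D x \subset S],
    [forall x in P, forall y in P, (x == y) || [disjoint D x & D y]]
    & [forall v in S, exists x in P, v \in D x]]].

Lemma exact_coversP S P :
  reflect [/\ P \subset K, forall x, x \in P -> D x \subset S,
      forall x y v, x \in P -> y \in P -> v \in D x -> v \in D y -> x = y
    & forall v, v \in S -> exists2 x, x \in P & v \in D x]
  (P \in exact_covers S).
Proof.
rewrite inE; apply: (iffP and4P) => -[PK PS Pd Pc]; split=> //.
- by move=> x xP; have /forall_inP/(_ _ xP) := PS.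
- move=> x y v xP yP vx vy.
  have /forall_inP/(_ _ xP)/forall_inP/(_ _ yP)/orP[/eqP//|] := Pd.
  by move=> /pred0P/(_ v) /=; rewrite vx vy.
- by move=> v vS; have /forall_inP/(_ _ vS)/exists_inP := Pc.
- by apply/forall_inP => x /PS.
- apply/forall_inP => x xP; apply/forall_inP => y yP.
  have [//|xy /=] := eqVneq x y; apply/pred0P => v /=.
  by apply/negP => /andP[vx vy]; rewrite (Pd x y v) ?eqxx in xy.
- by apply/forall_inP => v vS; apply/exists_inP; apply: Pc.
Qed.

Lemma exact_covers_del S P x :
  P \in exact_covers S -> x \in P -> P :\ x \in exact_covers (S :\: D x).
Proof.
move=> /exact_coversP[PK PS Pd Pc] xP; apply/exact_coversP; split.
- by apply: subset_trans PK; apply: subD1set.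
- move=> y /setD1P[yx yP]; rewrite subsetD PS //=.
  apply/pred0P => v /=; apply/negP => /andP[vy vx].
  by rewrite (Pd y x v) ?eqxx in yx.
- by move=> y z v /setD1P[_ yP] /setD1P[_ zP]; apply: Pd.
- move=> v /setDP[vS vx]; have [y yP vy] := Pc v vS.
  by exists y => //; rewrite !inE yP andbT; apply: contraNneq vx => <-.
Qed.

Lemma exact_covers_add S Q x : x \in K -> D x \subset S ->
  Q \in exact_covers (S :\: D x) -> (x \notin Q) /\ (x |: Q \in exact_covers S).
Proof.
move=> xK xS /exact_coversP[QK QS Qd Qc].
have disj y v : y \in Q -> v \in D y -> v \in D x -> false.
  by move=> yQ vy vx; have := subsetP (QS y yQ) v vy; rewrite inE vx.
split.
  have /set0Pn[v vx] := D_neq0 xK.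
  by apply/negP => xQ; have := disj x v xQ vx vx.
apply/exact_coversP; split.
- by rewrite subUset sub1set xK.
- by move=> y /setU1P[->//|yQ]; apply: subset_trans (QS y yQ) _; apply: subsetDl.
- move=> y z v /setU1P[->|yQ] /setU1P[->|zQ] vy vz //.
  + by have := disj z v zQ vz vy.
  + by have := disj y v yQ vy vz.
  + exact: Qd vy vz.
- move=> v vS; have [vx|vx] := boolP (v \in D x).
    by exists x => //; rewrite setU11.
  have [|y yQ vy] := Qc v; first by rewrite inE vx.
  by exists y => //; rewrite inE yQ orbT.
Qed.

(** Removing [x] is a bijection from the covers of [S] through [x] to the covers of the remaining
    vertices. Since [D x] is nonempty, [x] is never a piece of the latter, so adding it back inverts
    the removal. *)
Lemma sum_exact_covers_with S x (f : {set X} -> nat) :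
    x \in K -> D x \subset S ->
  \sum_(P in exact_covers S | x \in P) f P =
  \sum_(Q in exact_covers (S :\: D x)) f (x |: Q).
Proof.
move=> xK xS.
rewrite (reindex_onto (fun Q => x |: Q) (fun P => P :\ x)) /=; last first.
  by move=> P /andP[_ xP]; rewrite setD1K.
apply: eq_bigl => Q; rewrite setU11 andbT.
apply/andP/idP => [[PS /eqP xQ]|QS].
  by rewrite -xQ; apply: exact_covers_del; rewrite ?setU11.
have [xQ ->] := exact_covers_add xK xS QS; split=> //.
by rewrite setU1K.
Qed.

(** Exactly one piece of a cover contains [v]; the covers are sorted by that piece. *)
Lemma card_exact_covers_rec S v : v \in S ->
  #|exact_covers S| =
  \sum_(x in [set x in K | (v \in D x) && (D x \subset S)])
     #|exact_covers (S :\: D x)|.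
Proof.
move=> vS; transitivity (\sum_(P in exact_covers S)
    \sum_(x in [set x in K | (v \in D x) && (D x \subset S)] | x \in P) 1).
  rewrite -sum1_card; apply: eq_bigr => P /exact_coversP[PK PS Pd Pc].
  have [x xP vx] := Pc v vS.
  rewrite (big_pred1 x) // => y; rewrite inE.
  apply/idP/eqP => [/andP[/and3P[_ vy _] yP]|->]; first exact: Pd vy vx.
  by rewrite (subsetP PK) // vx PS.
rewrite (exchange_big_dep
  (fun x => x \in [set x in K | (v \in D x) && (D x \subset S)])) /=; last first.
  by move=> P x _ /andP[].
apply: eq_bigr => x xI; have := xI; rewrite inE => /and3P[xK vx xS].
rewrite -sum1_card -(sum_exact_covers_with (fun=> 1)) //.
by apply: eq_bigl => P; rewrite xK vx xS.
Qed.

(** The falling factorial counts ordered tuples of distinct pieces from [L]. Fixing the first entry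
    [x] and removing it from the cover leaves a tuple of length [j] in a cover of the remaining
    vertices. *)
Lemma ffact_sum_exact_covers S (L : {set X}) j : L \subset K ->
  \sum_(P in exact_covers S) #|P :&: L| ^_ j.+1 =
  \sum_(x in L | D x \subset S)
     \sum_(Q in exact_covers (S :\: D x)) #|Q :&: L| ^_ j.
Proof.
move=> LK; transitivity (\sum_(P in exact_covers S)
    \sum_(x in P :&: L) (#|P :&: L|.-1) ^_ j).
  by apply: eq_bigr => P _; rewrite sum_nat_const ffactnS.
rewrite (exchange_big_dep (fun x => (x \in L) && (D x \subset S))) /=; last first.
  by move=> P x /exact_coversP[_ PS _ _] /setIP[/PS-> ->].
apply: eq_bigr => x /andP[xL xS]; have xK := subsetP LK x xL.
transitivity (\sum_(P in exact_covers S | x \in P) #|P :&: L|.-1 ^_ j).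
  by apply: eq_bigl => P; rewrite in_setI xL andbT.
rewrite sum_exact_covers_with //; apply: eq_bigr => Q QS.
have [xQ _] := exact_covers_add xK xS QS.
have -> : (x |: Q) :&: L = x |: (Q :&: L).
  by rewrite setIUl; congr (_ :|: _); apply/setIidPl; rewrite sub1set.
by rewrite cardsU1 inE (negPf xQ).
Qed.

(** A cover without a piece straddling [C] is determined by its restrictions to [C] and to the
    complement, and these are covers themselves. *)
Lemma card_split_exact_covers (C : {set T}) :
  #|[set P in exact_covers setT |
       [forall x in P, (D x \subset C) || (D x \subset ~: C)]]| <=
  #|exact_covers C| * #|exact_covers (~: C)|.
Proof.
pose r (C' : {set T}) (P : {set X}) := [set x in P | D x \subset C'].
rewrite -cardsX -(card_in_imset (f := fun P => (r C P, r (~: C) P))).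
  apply: subset_leq_card; apply/subsetP => z /imsetP[P]; rewrite inE.
  move=> /andP[/exact_coversP[PK _ Pd Pc] /forall_inP Ps] ->.
  have rP (C' : {set T}) :
      (forall x v, x \in P -> v \in D x -> v \in C' -> D x \subset C') ->
      r C' P \in exact_covers C'.
    move=> cl; apply/exact_coversP; split.
    - by apply: subset_trans PK; apply/subsetP => x; rewrite inE => /andP[].
    - by move=> x; rewrite inE => /andP[].
    - by move=> x y v /setIdP[xP _] /setIdP[yP _]; apply: Pd.
    - move=> v vC; have [//|x xP vx] := Pc v.
      by exists x => //; rewrite inE xP (cl x v).
  apply/setXP; split; apply: rP => x v xP vx vC.
    have /orP[//|sub] := Ps x xP.
    by have := subsetP sub v vx; rewrite inE vC.
  have /orP[sub|//] := Ps x xP.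
  by move: vC; rewrite inE (subsetP sub v vx).
have rU (P : {set X}) : P \in [set P in exact_covers setT |
       [forall x in P, (D x \subset C) || (D x \subset ~: C)]] ->
    P = r C P :|: r (~: C) P.
  rewrite inE => /andP[_ /forall_inP Ps]; apply/setP => x; rewrite !inE -andb_orr.
  by have [/Ps ->|] := boolP (x \in P).
by move=> P Q PS QS [e1 e2]; rewrite (rU P) // (rU Q) // e1 e2.
Qed.

End ExactCovers.

(** * Counting sequences and factorial moments *)

Fixpoint num_a (n : nat) : nat :=
  match n with
  | 0 => 1
  | n1.+1 => match n1 with 0 => 1 | n2.+1 => num_a n1 + n1 * num_a n2 end
  end.

(** Like [num_a], the sequence of involution numbers, this one is given by its recurrence on the
    piece at a fixed vertex: a loop, one of 2(n-1) directed edges, or one of (n-1)(n-2) directed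
    triangles. *)
Fixpoint num_b (n : nat) : nat :=
  match n with
  | 0 => 1
  | n1.+1 =>
    match n1 with
    | 0 => 1
    | n2.+1 =>
      match n2 with
      | 0 => 3
      | n3.+1 => num_b n1 + 2 * n1 * num_b n2 + n1 * n2 * num_b n3
      end
    end
  end.

Lemma num_aSS n : num_a n.+2 = num_a n.+1 + n.+1 * num_a n.
Proof. by []. Qed.

Lemma num_bSSS n :
  num_b n.+3 = num_b n.+2 + 2 * n.+2 * num_b n.+1 + n.+2 * n.+1 * num_b n.
Proof. by []. Qed.

(* The j-th factorial moment, times the total count, of the number of pieces of
   size d in a structure on n vertices; g n is the number of available pieces. *)
Fixpoint moment (num g : nat -> nat) (d j n : nat) : nat :=
  if j is j'.+1 then g n * moment num g d j' (n - d) else num n.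

(** Induction on [j]: each of the [g #|S|] choices of a first piece leaves [#|S| - d] vertices, and
    all choices contribute equally because the counts depend on cardinals only. *)
Lemma moment_exact_covers (T X : finType) (D : X -> {set T}) (K L : {set X})
    (num g : nat -> nat) (d : nat) :
    (forall x, x \in K -> D x != set0) ->
    (forall S, #|exact_covers D K S| = num #|S|) ->
    L \subset K -> (forall x, x \in L -> #|D x| = d) ->
    (forall S : {set T}, #|[set x in L | D x \subset S]| = g #|S|) ->
  forall j S, \sum_(P in exact_covers D K S) #|P :&: L| ^_ j =
    moment num g d j #|S|.
Proof.
move=> K0 numE LK Ld gE; elim=> [|j IHj] S.
  by rewrite /= -numE -sum1_card; apply: eq_bigr => P _; rewrite ffactn0.
rewrite ffact_sum_exact_covers // (eq_bigr (fun=> moment num g d j (#|S| - d))).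
  by rewrite sum_nat_const /= -gE; congr (_ * _); apply: eq_card => x; rewrite !inE.
move=> x /andP[xL xS]; rewrite IHj cardsD (setIidPr xS).
by rewrite Ld.
Qed.

(** * a-structures *)

Section APieces.
Variable T : finType.
Implicit Types (S e : {set T}) (v w : T).

Definition a_pieces : {set {set T}} := [set e : {set T} | 0 < #|e| <= 2].
Definition a_loop_pieces : {set {set T}} := [set e : {set T} | #|e| == 1].

Notation a_covers := (exact_covers (@id {set T}) a_pieces).

Lemma a_pieces_neq0 (e : {set T}) : e \in a_pieces -> e != set0.
Proof. by rewrite inE card_gt0 => /andP[]. Qed.

Lemma a_pieces_at S v : v \in S ->
  [set e in a_pieces | (v \in e) && (e \subset S)] =
  [set v] |: [set [set v; w] | w in S :\ v].
Proof.
move=> vS; apply/setP => e; rewrite !inE; apply/idP/idP.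
  move=> /and3P[/andP[e0 e2] ve eS].
  have := cardsD1 v e; rewrite ve => ce.
  have [e1|[w ew]] := set_0Vmem (e :\ v).
    by rewrite -[e](setD1K ve) e1 setU0 eqxx.
  apply/orP; right; apply/imsetP; exists w.
    by have := ew; rewrite !inE => /andP[-> /(subsetP eS) ->].
  apply/eqP; rewrite eq_sym eqEcard; have := ew; rewrite !inE => /andP[wv we].
  by rewrite subUset !sub1set ve we cards2 eq_sym wv.
case/orP=> [/eqP->|/imsetP[w]].
  by rewrite cards1 set11 sub1set vS.
rewrite !inE => /andP[wv wS] ->; rewrite cards2 eq_sym wv set21 subUset !sub1set.
by rewrite vS wS.
Qed.

Lemma set2_injr v : {in predC1 v &, injective (fun w => [set v; w])}.
Proof.
move=> w x wv xv /setP/(_ w); rewrite !inE eqxx orbT.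
by rewrite !inE in wv; rewrite (negPf wv) /= => /esym/eqP.
Qed.

Lemma card_a_covers S : #|a_covers S| = num_a #|S|.
Proof.
have [n] := ubnP #|S|; elim: n S => // n IHn S leSn.
have [->|/set0Pn[v vS]] := eqVneq S set0.
  rewrite cards0 /=; apply/eqP/cards1P; exists set0; apply/setP => P.
  rewrite [RHS]inE; apply/exact_coversP/eqP => [[PK PS _ _]|->].
    apply/eqP; rewrite -subset0; apply/subsetP => e eP.
    have := a_pieces_neq0 (subsetP PK e eP).
    by have := PS e eP; rewrite subset0 => ->.
  by split=> // [|x|x y v|v]; rewrite ?sub0set ?inE.
have [m Sm] : {m | #|S :\ v| = m} by eexists.
have cS : #|S| = m.+1 by rewrite (cardsD1 v S) vS Sm.
rewrite (card_exact_covers_rec a_pieces_neq0 vS) a_pieces_at //.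
rewrite big_setU1 /=; last first.
  apply/negP => /imsetP[w]; rewrite !inE => /andP[wv _] /setP/(_ w).
  by rewrite !inE (negPf wv) eqxx orbT.
rewrite big_imset /=; last first.
  by move=> w x /setD1P[wv _] /setD1P[xv _]; apply: set2_injr.
rewrite IHn ?Sm; last by rewrite -ltnS -cS.
rewrite (eq_bigr (fun=> num_a m.-1)); last first.
  move=> w /setD1P[wv wS]; have -> : S :\: [set v; w] = S :\ v :\ w.
    by apply/setP => x; rewrite !inE negb_or andbCA andbA.
  have := cardsD1 w (S :\ v); rewrite !inE wv wS Sm => Sw.
  have {}Sw : m = #|S :\ v :\ w|.+1 by rewrite Sw.
  rewrite IHn; first by rewrite Sw.
  by rewrite -ltnS; apply: leq_trans leSn; rewrite cS Sw.
(* For [m = 0] the truncated [m.-1] is harmless, as its term carries the factor [m]. *)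
rewrite sum_nat_const Sm cS; case: m {Sm cS} => [|m] //=.
Qed.

Lemma card_a_loop_pieces S :
  #|[set e in a_loop_pieces | e \subset S]| = #|S|.
Proof.
rewrite -(card_imset _ (@set1_inj T)); apply: eq_card => e; rewrite !inE.
apply/andP/imsetP => [[/cards1P[v ->]]|[v vS ->]].
  by rewrite sub1set => vS; exists v.
by rewrite cards1 sub1set vS.
Qed.

Lemma moment_a_loops j S :
  \sum_(P in a_covers S) #|P :&: a_loop_pieces| ^_ j =
  moment num_a id 1 j #|S|.
Proof.
apply: moment_exact_covers => [e|S'|||].
- exact: a_pieces_neq0.
- exact: card_a_covers.
- by apply/subsetP => e; rewrite !inE => /eqP->.
- by move=> e; rewrite inE => /eqP.
- exact: card_a_loop_pieces.
Qed.

End APieces.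

(** * b-structures *)

Section BPieces.
Variable T : finType.
Implicit Types (S : {set T}) (v w x : T) (c : {set T * T}).

Definition triangle v w x : {set T * T} := [set (v, w); (w, x); (x, v)].

Definition b_verts c : {set T} :=
  [set v | [exists p in c, (v == p.1) || (v == p.2)]].
(* A piece of a b-structure is encoded by its set of b-edges, so that the
   triangle pieces do not depend on a starting vertex. *)
Definition b_loop_pieces : {set {set T * T}} := [set [set (v, v)] | v : T].
Definition b_edge_pieces : {set {set T * T}} :=
  [set [set p] | p : T * T & p.1 != p.2].
Definition b_triangle_pieces : {set {set T * T}} :=
  [set triangle t.1.1 t.1.2 t.2 | t : T * T * T & uniq [:: t.1.1; t.1.2; t.2]].
Definition b_pieces : {set {set T * T}} :=
  b_loop_pieces :|: b_edge_pieces :|: b_triangle_pieces.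

Notation b_covers := (exact_covers b_verts b_pieces).

Lemma b_vertsP c v :
  reflect (exists2 p, p \in c & (v == p.1) || (v == p.2)) (v \in b_verts c).
Proof. by rewrite inE; apply: exists_inP. Qed.

Lemma b_verts1 (p : T * T) : b_verts [set p] = [set p.1; p.2].
Proof.
apply/setP => v; rewrite [RHS]inE !in_set1; apply/b_vertsP/idP => [[q]|vp].
  by rewrite inE => /eqP->.
by exists p => //; rewrite inE.
Qed.

Lemma b_verts_triangle v w x : b_verts (triangle v w x) = [set v; w; x].
Proof.
apply/setP => y; rewrite !inE; apply/exists_inP/idP => [[p]|].
  by rewrite !inE -orbA => /or3P[] /eqP-> /= /orP[] /eqP->; rewrite eqxx ?orbT.
rewrite -orbA => /or3P[] /eqP->.
- by exists (v, w); rewrite ?inE ?eqxx.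
- by exists (w, x); rewrite ?inE ?eqxx ?orbT.
- by exists (x, v); rewrite ?inE ?eqxx ?orbT.
Qed.

Lemma b_piecesP c :
  reflect [\/ exists v, c = [set (v, v)],
              exists v w, v != w /\ c = [set (v, w)]
            | exists v w x, uniq [:: v; w; x] /\ c = triangle v w x]
          (c \in b_pieces).
Proof.
rewrite !in_setU -orbA; apply: (iffP or3P) => -[].
- by case/imsetP => v _ ->; apply: Or31; exists v.
- by case/imsetP => -[v w]; rewrite inE /= => vw ->; apply: Or32; exists v, w.
- case/imsetP => -[[v w] x]; rewrite inE /= => vwx ->; apply: Or33.
  by exists v, w, x.
- by case=> v ->; apply: Or31; apply: imset_f.
- by case=> v [w [vw ->]]; apply: Or32; apply/imsetP; exists (v, w); rewrite ?inE.
- case=> v [w [x [vwx ->]]]; apply: Or33; apply/imsetP.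
  by exists (v, w, x); rewrite ?inE.
Qed.

Lemma b_pieces_neq0 c : c \in b_pieces -> b_verts c != set0.
Proof.
case/b_piecesP => [[v ->]|[v [w [_ ->]]]|[v [w [x [_ ->]]]]];
  rewrite ?b_verts1 ?b_verts_triangle; apply/set0Pn; exists v;
  by rewrite !inE eqxx.
Qed.

Lemma triangle_rot v w x : triangle v w x = triangle w x v.
Proof. by rewrite /triangle -setUA setUC. Qed.

(** A triangle through [v] is rotated so as to start at [v]; it is then indexed by an ordered pair
    of distinct other vertices. *)
Lemma b_pieces_at S v : v \in S ->
  [set c in b_pieces | (v \in b_verts c) && (b_verts c \subset S)] =
  [set [set (v, v)]] :|: [set [set (v, w)] | w in S :\ v]
    :|: [set [set (w, v)] | w in S :\ v]
    :|: [set triangle v p.1 p.2 | p in [set p : T * T |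
           (p.1 \in S :\ v) && (p.2 \in S :\ v :\ p.1)]].
Proof.
move=> vS; apply/setP => c; rewrite !in_setU [LHS]inE in_set1 -!orbA.
apply/and3P/or4P => [[/b_piecesP[[w ->]|[w [x [wx ->]]]|[w [x [y [wxy ->]]]]]]|].
- by rewrite b_verts1 /= !inE orbb => /eqP-> _; constructor 1.
- rewrite b_verts1 /= subUset !sub1set in_set2.
  case/orP => /eqP vE; [subst w|subst x] => /andP[wS xS].
    by constructor 2; apply/imset_f; rewrite !inE eq_sym wx.
  by constructor 3; apply/imset_f; rewrite !inE wx.
- rewrite b_verts_triangle !subUset !sub1set !inE -orbA => vwxy.
  case/andP => /andP[wS xS] yS; constructor 4.
  move: wxy; rewrite /= !inE negb_or andbT => /andP[/andP[wx wy] xy].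
  apply/imsetP; case/or3P: vwxy => /eqP vE.
  + exists (x, y); last by rewrite vE.
    by rewrite !inE /= vE xS yS eq_sym wx eq_sym xy eq_sym wy.
  + exists (y, w); last by rewrite vE triangle_rot.
    by rewrite !inE /= vE yS wS wx eq_sym xy wy.
  + exists (w, x); last by rewrite vE -triangle_rot.
    by rewrite !inE /= vE wS xS wy xy eq_sym wx.
case=> [/eqP->|/imsetP[w wS ->]|/imsetP[w wS ->]|/imsetP[[w x] wxS ->]].
- rewrite b_verts1 /= setUid sub1set vS set11; split=> //.
  by apply/b_piecesP; constructor 1; exists v.
- move: wS; rewrite in_setD1 => /andP[wv wS].
  rewrite b_verts1 subUset !sub1set vS wS set21; split=> //.
  by apply/b_piecesP; constructor 2; exists v, w; rewrite eq_sym.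
- move: wS; rewrite in_setD1 => /andP[wv wS].
  rewrite b_verts1 subUset !sub1set vS wS set22; split=> //.
  by apply/b_piecesP; constructor 2; exists w, v.
- move: wxS; rewrite [_ \in _]inE /= !in_setD1 => /and3P[/andP[wv wS] xw /andP[xv xS]].
  rewrite b_verts_triangle !subUset !sub1set vS wS xS.
  have -> : v \in [set v; w; x] by rewrite !inE eqxx.
  split=> //.
  apply/b_piecesP; constructor 3; exists v, w, x; split=> //=.
  by rewrite !inE negb_or (eq_sym v) wv (eq_sym v) xv (eq_sym w) xw.
Qed.

Lemma mem_triangle v w x (p : T * T) :
  (p \in triangle v w x) = [|| p == (v, w), p == (w, x) | p == (x, v)].
Proof. by rewrite !inE -orbA. Qed.

(** The edge leaving [v] determines the second vertex, and the edge leaving that one determines the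
    third. *)
Lemma triangle_inj v (p q : T * T) : p.1 != v -> p.2 != v ->
    q.1 != v -> q.2 != v ->
  triangle v p.1 p.2 = triangle v q.1 q.2 -> p = q.
Proof.
case: p q => [w x] [w' x'] /= wv xv wv' xv' E.
have: (v, w) \in triangle v w' x' by rewrite -E mem_triangle eqxx.
rewrite mem_triangle !xpair_eqE (eq_sym v w') (eq_sym v x').
rewrite (negPf wv') (negPf xv') eqxx /= orbF => /eqP ww.
have: (w, x) \in triangle v w' x' by rewrite -E mem_triangle eqxx orbT.
rewrite mem_triangle !xpair_eqE (negPf wv) (negPf xv) andbF orbF /=.
by case/andP => _ /eqP->; rewrite ww.
Qed.

Lemma sum_setU (I : finType) (A B : {set I}) (F : I -> nat) :
    (forall i, i \in A -> i \in B -> false) ->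
  \sum_(i in A :|: B) F i = \sum_(i in A) F i + \sum_(i in B) F i.
Proof.
move=> dAB; rewrite -bigU /=; first by apply: eq_bigl => i; rewrite !inE.
by apply/pred0P => i /=; apply/negP => /andP[iA iB]; have := dAB i iA iB.
Qed.

Lemma card_b_covers S : #|b_covers S| = num_b #|S|.
Proof.
have [n] := ubnP #|S|; elim: n S => // n IHn S leSn.
have [->|/set0Pn[v vS]] := eqVneq S set0.
  rewrite cards0 /=; apply/eqP/cards1P; exists set0; apply/setP => P.
  rewrite [RHS]inE; apply/exact_coversP/eqP => [[PK PS _ _]|->].
    apply/eqP; rewrite -subset0; apply/subsetP => c cP.
    have := b_pieces_neq0 (subsetP PK c cP).
    by have := PS c cP; rewrite subset0 => ->.
  by split=> // [|x|x y w|w]; rewrite ?sub0set ?inE.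
have [m Sm] : {m | #|S :\ v| = m} by eexists.
have cS : #|S| = m.+1 by rewrite (cardsD1 v S) vS Sm.
have lemn : m < n by rewrite -ltnS -cS.
have two w : w \in S :\ v -> #|S :\: [set v; w]| = m.-1.
  rewrite !inE => /andP[wv wS].
  rewrite cardsD (setIidPr _) ?cS ?cards2 ?(eq_sym v) ?wv ?subn2 //.
  by rewrite subUset !sub1set vS.
have IH2 w : w \in S :\ v -> #|b_covers (S :\: [set v; w])| = num_b m.-1.
  by move=> wS; rewrite IHn two //; apply: leq_ltn_trans (leq_pred m) lemn.
have three w x : w \in S :\ v -> x \in S :\ v :\ w ->
    #|S :\: [set v; w; x]| = m.-2.
  move=> wS xS; have -> : S :\: [set v; w; x] = S :\: [set v; w] :\ x.
    apply/setP => y; rewrite !inE !negb_or.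
    by case: (y == v); case: (y == x); case: (y == w).
  have := cardsD1 x (S :\: [set v; w]); rewrite two // => ->.
  by move: xS; rewrite !inE !negb_or => /and3P[-> -> ->].
rewrite (card_exact_covers_rec b_pieces_neq0 vS) b_pieces_at //.
set A1 := [set [set (v, v)]]; set A2 := [set [set (v, w)] | w in S :\ v].
set A3 := [set [set (w, v)] | w in S :\ v]; set A4 := [set triangle _ _ _ | p in _].
have d12 c : c \in A1 -> c \in A2 -> false.
  rewrite in_set1 => /eqP-> /imsetP[w]; rewrite in_setD1 => /andP[wv _].
  by move/set1_inj => [/eqP]; rewrite eq_sym (negPf wv).
have d13 c : c \in A1 :|: A2 -> c \in A3 -> false.
  rewrite in_setU in_set1 => cA /imsetP[x]; rewrite in_setD1 => /andP[xv _] cE.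
  move: cA; rewrite cE => /orP[/eqP|/imsetP[w]].
    by move=> /set1_inj[/eqP]; rewrite (negPf xv).
  by move=> _ /set1_inj[/eqP]; rewrite (negPf xv).
have d14 c : c \in A1 :|: A2 :|: A3 -> c \in A4 -> false.
  move=> cA /imsetP[[w x]]; rewrite inE /= => /andP[].
  rewrite !in_setD1 => /andP[wv _] _ cE.
  (* A triangle has two different edges, so it is not a singleton like the loop and edge pieces. *)
  have cN p : c = [set p] -> False.
    move=> cp; have : (v, w) \in c by rewrite cE mem_triangle eqxx.
    have : (w, x) \in c by rewrite cE mem_triangle eqxx orbT.
    by rewrite cp !in_set1 => /eqP<- /eqP[/esym/eqP]; rewrite (negPf wv).
  move: cA; rewrite !in_setU in_set1 -orbA.
  by case/or3P => [/eqP/cN|/imsetP[y _ /cN]|/imsetP[y _ /cN]].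
rewrite (sum_setU _ d14) (sum_setU _ d13) (sum_setU _ d12) /=.
rewrite /A1 /A2 /A3 /A4 {A1 A2 A3 A4 d12 d13 d14}.
rewrite big_set1 b_verts1 /= setUid IHn ?Sm //.
rewrite !big_imset /=; first last.
- by move=> w x _ _ /set1_inj[].
- by move=> w x _ _ /set1_inj[].
- move=> [w x] [w' x']; rewrite !inE /= => /and3P[/andP[wv _] _ /andP[xv _]].
  move=> /and3P[/andP[wv' _] _ /andP[xv' _]].
  exact: (@triangle_inj v (w, x) (w', x')).
have cP : #|[set p : T * T | (p.1 \in S :\ v) && (p.2 \in S :\ v :\ p.1)]| = m * m.-1.
  rewrite -sum1_card (eq_bigl (fun p => (p.1 \in S :\ v) && (p.2 \in S :\ v :\ p.1))).
    rewrite -(pair_big_dep (fun w => w \in S :\ v) (fun w x => x \in S :\ v :\ w)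
      (fun _ _ => 1)) /=.
    rewrite (eq_bigr (fun=> m.-1)) ?sum_nat_const ?Sm // => w wS.
    by rewrite sum1_card; have := cardsD1 w (S :\ v); rewrite wS Sm => ->.
  by move=> p; rewrite inE.
have -> : \sum_(w in S :\ v) #|b_covers (S :\: b_verts [set (v, w)])| = m * num_b m.-1.
  rewrite (eq_bigr (fun=> num_b m.-1)) ?sum_nat_const ?Sm // => w wS.
  by rewrite b_verts1 IH2.
have -> : \sum_(w in S :\ v) #|b_covers (S :\: b_verts [set (w, v)])| = m * num_b m.-1.
  rewrite (eq_bigr (fun=> num_b m.-1)) ?sum_nat_const ?Sm // => w wS.
  by rewrite b_verts1 /= setUC IH2.
rewrite (eq_bigr (fun=> num_b m.-2)); last first.
  move=> [w x]; rewrite inE /= => /andP[wS xS].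
  by rewrite b_verts_triangle IHn three // (leq_ltn_trans _ lemn) // -subn2 leq_subr.
rewrite sum_nat_const cP cS.
(* The cases [m = 0] and [m = 1], where the predecessors are truncated, hold by computation. *)
case: m {Sm cS lemn two three IH2 cP} => [|[|m]]; [by []|by []|].
rewrite num_bSSS !succnK.
by rewrite mul2n -addnn mulnDl !addnA.
Qed.

Lemma card_b_loop_pieces S :
  #|[set c in b_loop_pieces | b_verts c \subset S]| = #|S|.
Proof.
rewrite -(card_imset (f := fun v => [set (v, v)])) => [|v w /set1_inj[]//].
apply: eq_card => c; rewrite !inE.
apply/andP/imsetP => [[/imsetP[v _ ->]]|[v vS ->]].
  by rewrite b_verts1 setUid sub1set => vS; exists v.
by rewrite imset_f // b_verts1 setUid sub1set.
Qed.

Lemma card_b_edge_pieces S :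
  #|[set c in b_edge_pieces | b_verts c \subset S]| = #|S| * #|S|.-1.
Proof.
transitivity #|[set p : T * T | (p.1 \in S) && (p.2 \in S :\ p.1)]|.
  rewrite -[RHS](card_imset _ (@set1_inj _)); apply: eq_card => c.
  rewrite inE; apply/andP/imsetP => [[/imsetP[p + ->]]|[p + ->]].
    rewrite inE b_verts1 subUset !sub1set => pp /andP[p1 p2]; exists p => //.
    by rewrite !inE p1 p2 eq_sym pp.
  rewrite !inE => /and3P[p1 pp p2]; rewrite b_verts1 subUset !sub1set p1 p2.
  by split=> //; apply/imsetP; exists p; rewrite // inE eq_sym.
rewrite -sum1_card (eq_bigl (fun p => (p.1 \in S) && (p.2 \in S :\ p.1))).
  rewrite -(pair_big_dep (fun w => w \in S) (fun w x => x \in S :\ w)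
    (fun _ _ => 1)) /=.
  rewrite (eq_bigr (fun=> #|S|.-1)) ?sum_nat_const // => w wS.
  by rewrite sum1_card (cardsD1 w S) wS.
by move=> p; rewrite inE.
Qed.

Lemma moment_b_loops j S :
  \sum_(P in b_covers S) #|P :&: b_loop_pieces| ^_ j =
  moment num_b id 1 j #|S|.
Proof.
apply: moment_exact_covers => [c|S'|||].
- exact: b_pieces_neq0.
- exact: card_b_covers.
- by apply/subsetP => c cL; rewrite !in_setU cL.
- by move=> c /imsetP[v _ ->]; rewrite b_verts1 setUid cards1.
- exact: card_b_loop_pieces.
Qed.

Lemma moment_b_edges j S :
  \sum_(P in b_covers S) #|P :&: b_edge_pieces| ^_ j =
  moment num_b (fun n => n * n.-1) 2 j #|S|.
Proof.
apply: moment_exact_covers => [c|S'|||].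
- exact: b_pieces_neq0.
- exact: card_b_covers.
- by apply/subsetP => c cL; rewrite !in_setU cL orbT.
- by move=> c /imsetP[p + ->]; rewrite inE b_verts1 cards2 => ->.
- exact: card_b_edge_pieces.
Qed.

End BPieces.

(** * The b-edges of a graph as a b-structure *)

Section BStructures.
Variable T : finType.
Implicit Types (G : graph T) (v w x : T) (c : {set T * T}) (p q : T * T)
  (F : {set T * T}).

Notation b_covers := (exact_covers (@b_verts T) (b_pieces T)).

(* The last condition keeps the single edges of a triangle from being pieces. *)
Definition pieces_of F : {set {set T * T}} :=
  [set c in b_pieces T | (c \subset F) &&
    [forall p in F, ((p.1 \in b_verts c) || (p.2 \in b_verts c)) ==> (p \in c)]].

Lemma pieces_ofP F c :
  reflect [/\ c \in b_pieces T, c \subset F &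
    forall p, p \in F -> (p.1 \in b_verts c) || (p.2 \in b_verts c) -> p \in c]
  (c \in pieces_of F).
Proof.
rewrite [X in reflect _ X]inE; apply: (iffP and3P) => -[cK cF cl]; split=> //.
  by move=> p pF pc; have /forall_inP/(_ p pF)/implyP := cl; apply.
by apply/forall_inP => p pF; apply/implyP; apply: cl.
Qed.

Lemma mem_b_verts c p : p \in c -> (p.1 \in b_verts c) /\ (p.2 \in b_verts c).
Proof. by move=> pc; split; apply/b_vertsP; exists p; rewrite ?eqxx ?orbT. Qed.

(** Two different edges can only come from a triangle, where any two of the three edges share a
    vertex. This makes pieces pairwise disjoint and keeps them inside one connected component. *)
Lemma piece_edges_meet c p q : c \in b_pieces T -> p \in c -> q \in c ->
  (q.1 \in [set p.1; p.2]) || (q.2 \in [set p.1; p.2]).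
Proof.
case/b_piecesP => [[v ->]|[v [w [_ ->]]]|[v [w [x [_ ->]]]]].
- by rewrite !inE => /eqP-> /eqP->; rewrite eqxx.
- by rewrite !inE => /eqP-> /eqP->; rewrite eqxx.
- by rewrite !mem_triangle => /or3P[] /eqP-> /or3P[] /eqP-> /=;
    rewrite !inE !eqxx ?orbT.
Qed.

Lemma pieces_of_disjoint F c c' v : c \in pieces_of F -> c' \in pieces_of F ->
  v \in b_verts c -> v \in b_verts c' -> c = c'.
Proof.
(* The edges of a piece meet pairwise, so a common vertex propagates. *)
have sub d d' u : d \in pieces_of F -> d' \in pieces_of F ->
    u \in b_verts d -> u \in b_verts d' -> d \subset d'.
  case/pieces_ofP => [dK dF _] /pieces_ofP[_ _ cl] /b_vertsP[p pd up] ud'.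
  have pd' : p \in d'.
    by apply: cl; [apply: (subsetP dF) | case/orP: up => /eqP <-; rewrite ud' ?orbT].
  have [p1 p2] := mem_b_verts pd'.
  apply/subsetP => q qd; apply: cl; first exact: (subsetP dF).
  have := piece_edges_meet dK pd qd; rewrite !in_set2 => /orP[] /orP[] /eqP->;
    by rewrite ?p1 ?p2 ?orbT.
by move=> cF cF' vc vc'; apply/eqP; rewrite eqEsubset (sub c c' v) // (sub c' c v).
Qed.

Lemma partial_injectiveP G :
  reflect (forall p q, p \in bedges G -> q \in bedges G ->
             (p.1 = q.1 -> p.2 = q.2) /\ (p.2 = q.2 -> p.1 = q.1))
          (partial_injective G).
Proof.
apply: (iffP forall_inP) => inj p; last first.
  move=> pG; apply/forall_inP => q qG; have [i1 i2] := inj p q pG qG.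
  by apply/andP; split; apply/implyP => /eqP e; apply/eqP; auto.
move=> q pG qG; have /forall_inP/(_ q qG)/andP[/implyP i1 /implyP i2] := inj p pG.
by split=> /eqP e; apply/eqP; auto.
Qed.

Lemma isolated_bedgeP G v w :
  reflect [/\ v != w, (v, w) \in bedges G & forall p, p \in bedges G ->
      (p.1 \in [set v; w]) || (p.2 \in [set v; w]) -> p = (v, w)]
    (isolated_bedge G v w).
Proof.
apply: (iffP and3P) => -[vw vwG iso]; split=> //.
  by move=> p pG pvw; apply/eqP; have /forall_inP/(_ p pG)/implyP := iso; apply.
by apply/forall_inP => p pG; apply/implyP => pvw; apply/eqP; apply: iso.
Qed.

Lemma loop_piece_of G v : partial_injective G -> (v, v) \in bedges G ->
  [set (v, v)] \in pieces_of (bedges G).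
Proof.
move=> /partial_injectiveP inj vG; apply/pieces_ofP; split.
- by apply/b_piecesP; constructor 1; exists v.
- by rewrite sub1set.
- move=> [p1 p2] pG; rewrite b_verts1 /= setUid !inE.
  have [i1 i2] := inj _ _ pG vG.
  rewrite /= in i1 i2.
  by case/orP => /eqP e; [rewrite e (i1 e) | rewrite e (i2 e)].
Qed.

Lemma edge_piece_of G v w : isolated_bedge G v w ->
  [set (v, w)] \in pieces_of (bedges G).
Proof.
case/isolated_bedgeP => vw vwG iso; apply/pieces_ofP; split.
- by apply/b_piecesP; constructor 2; exists v, w.
- by rewrite sub1set.
- by move=> p pG; rewrite b_verts1 in_set1 => /(iso p pG)->.
Qed.

(** Each vertex of the triangle is the source of one triangle edge and the target of another, so by
    partial injectivity any b-edge touching the triangle is one of its edges. *)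
Lemma triangle_piece_of G v w x : partial_injective G -> btriangle G v w x ->
  triangle v w x \in pieces_of (bedges G).
Proof.
move=> /partial_injectiveP inj /and4P[vwx vw wx xv]; apply/pieces_ofP; split.
- by apply/b_piecesP; constructor 3; exists v, w, x.
- by apply/subsetP => p; rewrite mem_triangle => /or3P[] /eqP->.
- move=> [p1 p2] pG; rewrite b_verts_triangle mem_triangle !inE /= !xpair_eqE.
  have [i1 i2] := inj _ _ pG vw.
  have [i3 i4] := inj _ _ pG wx.
  have [i5 i6] := inj _ _ pG xv.
  rewrite /= in i1 i2 i3 i4 i5 i6.
  by rewrite -!orbA => /or4P[|||/or3P[]] /eqP e;
    first [rewrite e (i1 e) | rewrite e (i2 e) | rewrite e (i3 e)
      | rewrite e (i4 e) | rewrite e (i5 e) | rewrite e (i6 e)];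
    rewrite !eqxx ?orbT.
Qed.

(** With the next three lemmas this shows that [pieces_of] and [cover] are inverse bijections
    between the b-edge sets satisfying [b_condition] and the exact covers of all vertices. Here
    [b_condition] supplies a piece at every vertex. *)
Lemma pieces_of_exact G : vertices G = setT -> b_condition G ->
  pieces_of (bedges G) \in b_covers setT.
Proof.
move=> GT /and3P[inj /forall_inP cov /forall_inP kind].
apply/exact_coversP; split.
- by apply/subsetP => c /pieces_ofP[].
- by move=> c _; apply: subsetT.
- exact: pieces_of_disjoint.
- move=> v _.
  have /exists_inP[p pG vp] : [exists p in bedges G, (p.1 == v) || (p.2 == v)].
    by apply: cov; rewrite GT inE.
  suff [c cP pc] : exists2 c, c \in pieces_of (bedges G) & p \in c.
    exists c => //; have [p1 p2] := mem_b_verts pc.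
    by case/orP: vp => /eqP <-.
  have := kind p pG; case: p pG {vp} => [x y] /= pG.
  case/or3P => [/eqP e|iso|/existsP[z tri]].
  + by rewrite -e in pG *; exists [set (x, x)]; rewrite ?set11 // loop_piece_of.
  + by exists [set (x, y)]; rewrite ?set11 // edge_piece_of.
  + by exists (triangle x y z); rewrite ?mem_triangle ?eqxx // triangle_piece_of.
Qed.

Lemma cover_pieces_of F : pieces_of F \in b_covers setT -> cover (pieces_of F) = F.
Proof.
case/exact_coversP => _ _ _ cov; apply/setP => p; apply/bigcupP/idP.
  by case=> c /pieces_ofP[_ /subsetP cF _] /cF.
have [//|c cF pc] := cov p.1; move=> pF; exists c => //.
by case/pieces_ofP: cF => _ _; apply=> //; rewrite pc.
Qed.

(** The pieces of [P] stay closed in the union because an edge touching one of them belongs to it.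
    Any further piece of the union meets some piece of [P], hence equals it. *)
Lemma pieces_of_cover (P : {set {set T * T}}) :
  P \in b_covers setT -> pieces_of (cover P) = P.
Proof.
case/exact_coversP => /subsetP PK _ Pd Pc.
have PF c : c \in P -> c \in pieces_of (cover P).
  move=> cP; apply/pieces_ofP; split; first exact: PK.
    exact: (bigcup_max c).
  move=> p /bigcupP[c' cP' pc'] pc; have [p1 p2] := mem_b_verts pc'.
  by case/orP: pc => pc; [rewrite (Pd c c' p.1) | rewrite (Pd c c' p.2)].
apply/setP => c; apply/idP/idP; last exact: PF.
move=> cF; have /pieces_ofP[cK _ _] := cF.
have /set0Pn[v vc] := b_pieces_neq0 cK.
have [//|c' cP' vc'] := Pc v.
by rewrite (pieces_of_disjoint cF (PF c' cP') vc vc').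
Qed.

Lemma b_condition_cover G : vertices G = setT ->
  pieces_of (bedges G) \in b_covers setT -> b_condition G.
Proof.
move=> GT PE; have GE := cover_pieces_of PE.
have [PK _ Pd Pc] := exact_coversP _ _ _ _ PE.
have inP p : p \in bedges G -> exists2 c, c \in pieces_of (bedges G) & p \in c.
  by rewrite -{1}GE => /bigcupP.
apply/and3P; split.
- apply/partial_injectiveP => p q /inP[c cP pc] /inP[d dP qd].
  have [p1 p2] := mem_b_verts pc; have [q1 q2] := mem_b_verts qd.
  (* Edges with a common source or target lie in the same piece, so injectivity is checked inside
     one piece of each kind. *)
  have key : c = d -> (p.1 = q.1 -> p.2 = q.2) /\ (p.2 = q.2 -> p.1 = q.1).
    move=> cd; rewrite -cd in qd; have /pieces_ofP[cK _ _] := cP.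
    case/b_piecesP: cK pc qd => [[v ->]|[v [w [_ ->]]]|[v [w [x [vwx ->]]]]].
    + by rewrite !inE => /eqP-> /eqP->.
    + by rewrite !inE => /eqP-> /eqP->.
    + have /andP[/andP[vw vx] wx] : (v != w) && (v != x) && (w != x).
        by move: vwx; rewrite /= !inE negb_or andbT.
      rewrite !mem_triangle => /or3P[] /eqP-> /or3P[] /eqP-> /=; split=> // /eqP;
        by rewrite ?(negPf vw) ?(negPf vx) ?(negPf wx) // eq_sym
                   ?(negPf vw) ?(negPf vx) ?(negPf wx).
  split=> e; have cd : c = d.
  + by apply: (Pd c d p.1) => //; rewrite e.
  + by have [i1 _] := key cd; apply: i1.
  + by apply: (Pd c d p.2) => //; rewrite e.
  + by have [_ i2] := key cd; apply: i2.
- apply/forall_inP => v _; have [//|c cP /b_vertsP[p pc vp]] := Pc v.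
  apply/exists_inP; exists p; last by rewrite !(eq_sym _ v).
  by case/pieces_ofP: cP => _ /subsetP/(_ p pc).
- apply/forall_inP => p /inP[c /pieces_ofP[cK cF cl]].
  case/b_piecesP: cK cF cl => [[v ->]|[v [w [vw ->]]]|[v [w [x [vwx ->]]]]] cF cl.
  + by rewrite inE => /eqP->; rewrite eqxx.
  + rewrite inE => /eqP->; apply/or3P; constructor 2; apply/isolated_bedgeP.
    split=> //=; first by rewrite -sub1set.
    by move=> q qG; rewrite -(b_verts1 (v, w)) => /(cl q qG); rewrite inE => /eqP.
  + have tri y : y \in triangle v w x -> y \in bedges G by move/(subsetP cF).
    have tG : btriangle G v w x.
      by rewrite /btriangle vwx !tri ?mem_triangle ?eqxx ?orbT.
    have /and4P[_ g1 g2 g3] := tG.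
    have /andP[/andP[vw vx] wx] : (v != w) && (v != x) && (w != x).
      by move: vwx; rewrite /= !inE negb_or andbT.
    rewrite mem_triangle => /or3P[] /eqP-> /=; apply/or3P; constructor 3; apply/existsP.
    - by exists x.
    - by exists v; rewrite /btriangle g1 g2 g3 /= !inE negb_or wx eq_sym vw eq_sym vx.
    - exists w; rewrite /btriangle g1 g2 g3 /= !inE negb_or.
      by rewrite (eq_sym x) vx (eq_sym x) wx vw.
Qed.

End BStructures.

(** * Moves *)

Section Moves.
Variable T : finType.
Implicit Types (G H : graph T) (D : {set T}) (v w x y : T).

Definition a_loops G : {set T} := [set v | aloop G v].
Definition b_loops G : {set T} := [set v | bloop G v].
Definition b_isolated G : {set T * T} := [set p | isolated_bedge G p.1 p.2].

(** The coefficients are forced one after the other: [kappa3] trades an isolated b-edge for two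
    vertices, whence 2; [lambda21] may turn an a-loop into an isolated b-edge while deleting one
    vertex, whence 3 = 2 + 1; [lambda3] may turn a b-loop into an a-loop while deleting one vertex,
    whence 4 = 3 + 1. *)
Definition weight G : nat :=
  2 * #|b_isolated G| + 3 * #|a_loops G| + 4 * #|b_loops G|.

Lemma isolated_delete D G x y :
    isolated_bedge (delete D G) x y ->
    (forall p, p \in bedges G -> (p.1 \in D) || (p.2 \in D) ->
       (p.1 \in [set x; y]) || (p.2 \in [set x; y]) -> False) ->
  isolated_bedge G x y.
Proof.
move=> /isolated_bedgeP[xy + iso] far; rewrite inE => /andP[xyG _].
apply/isolated_bedgeP; split=> // p pG pxy.
apply: iso => //; rewrite inE pG /= -negb_or.
by apply/negP => pD; apply: (far p).
Qed.

(** When [D] is closed under b-adjacency, no surviving b-edge loses a neighbouring b-edge, so none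
    becomes isolated. *)
Lemma b_isolated_delete D G :
    (forall p, p \in bedges G -> (p.1 \in D) || (p.2 \in D) ->
       (p.1 \in D) && (p.2 \in D)) ->
  b_isolated (delete D G) \subset b_isolated G.
Proof.
move=> cl; apply/subsetP => -[x y]; rewrite !inE /= => xyH.
apply: (isolated_delete xyH) => p pG /(cl p pG)/andP[p1 p2].
have /isolated_bedgeP[_ + _] := xyH; rewrite !inE /= => /and3P[_ xD yD].
by case/orP => /orP[] /eqP e; rewrite ?e ?(negPf xD) ?(negPf yD) in p1 p2.
Qed.

Lemma partial_injective_sub G H : bedges H \subset bedges G ->
  partial_injective G -> partial_injective H.
Proof.
move=> /subsetP sHG /partial_injectiveP inj; apply/partial_injectiveP.
by move=> p q /sHG pG /sHG qG; apply: inj.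
Qed.

Lemma delete_bedges D G : bedges (delete D G) \subset bedges G.
Proof. by apply/subsetP => p; rewrite inE => /andP[]. Qed.

Lemma b_loops_delete D G : b_loops (delete D G) \subset b_loops G :\: D.
Proof. by apply/subsetP => v; rewrite !inE /bloop !inE => /and3P[-> ->]. Qed.

Lemma a_loops_delete D G : a_loops (delete D G) \subset a_loops G :\: D.
Proof.
apply/subsetP => v; rewrite !inE /aloop !inE => /andP[-> /pred0P/(_ v) /=].
by rewrite inE eqxx /= => ->.
Qed.

Lemma a_loops_add_loop w G : a_loops (add_aedge [set w] G) \subset w |: a_loops G.
Proof.
apply/subsetP => v; rewrite !inE /aloop !inE => /orP[/eqP/set1_inj->|vG].
  by rewrite eqxx.
by apply/orP; right.
Qed.

Lemma a_loops_add_edge v w G : v != w ->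
  a_loops (add_aedge [set v; w] G) \subset a_loops G.
Proof.
move=> vw; apply/subsetP => x; rewrite !inE /aloop !inE => /orP[/eqP e|//].
by have := cards1 x; rewrite e cards2 vw.
Qed.

Lemma card_delete D G : #|vertices G| <= #|vertices (delete D G)| + #|D|.
Proof.
by rewrite /= addnC -leq_subLR cardsD leq_sub2l // subset_leq_card ?subsetIr.
Qed.

(** The b-loop at [v] pays 4, and at most one new a-loop costs 3. By partial injectivity the loop is
    the only b-edge at [v], so no b-edge becomes isolated. *)
Lemma lambda3_weight G H : partial_injective G -> lambda3 G H ->
  partial_injective H /\ #|vertices G| + weight H <= #|vertices H| + weight G.
Proof.
move=> inj /exists_inP[v vG /existsP[w /and3P[vl vw /eqP->]]].
split; first exact: partial_injective_sub (delete_bedges _ _) inj.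
have b1 : #|b_isolated (delete [set v] G)| <= #|b_isolated G|.
  apply/subset_leq_card/b_isolated_delete => -[p1 p2] pG; rewrite !inE /=.
  move/partial_injectiveP: inj => /(_ _ _ pG vl)[/= i1 i2].
  by case/orP => /eqP e; [rewrite e (i1 e) | rewrite e (i2 e)]; rewrite eqxx.
have b2 : #|b_loops (delete [set v] G)| < #|b_loops G|.
  by apply: leq_ltn_trans (subset_leq_card (b_loops_delete _ _)) _;
    rewrite [X in _ < X](cardsD1 v) inE vl.
have b3 : #|a_loops (add_aedge [set w] (delete [set v] G))| <= #|a_loops G|.+1.
  apply: leq_trans (subset_leq_card (a_loops_add_loop _ _)) _.
  rewrite cardsU1; apply: leq_add (leq_b1 _) _.
  by apply: leq_trans (subset_leq_card (a_loops_delete _ _)) _;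
    rewrite subset_leq_card ?subsetDl.
have b0 := card_delete [set v] G; rewrite cards1 in b0.
set H' := add_aedge _ _.
rewrite -[#|vertices (delete _ _)|]/(#|vertices H'|) in b0.
rewrite -[#|b_isolated (delete _ _)|]/(#|b_isolated H'|) in b1.
rewrite -[#|b_loops (delete _ _)|]/(#|b_loops H'|) in b2.
rewrite -/H' in b3; rewrite /weight; lia.
Qed.

(** The a-loop at [v] pays 3, and the only b-edge that can become isolated, [(w', w)], costs 2. *)
Lemma lambda21_weight G H : partial_injective G -> lambda21 G H ->
  partial_injective H /\ #|vertices G| + weight H <= #|vertices H| + weight G.
Proof.
move=> inj /exists_inP[v vG /existsP[w /existsP[w' /and3P[va tri /eqP->]]]].
split; first exact: partial_injective_sub (delete_bedges _ _) inj.
have b1 : #|b_isolated (delete [set v] G)| <= #|b_isolated G|.+1.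
  rewrite -add1n; apply: (@leq_trans #|(w', w) |: b_isolated G|).
    apply/subset_leq_card/subsetP => -[x y]; rewrite !inE /= => xyH.
    have [//|xyE /=] := eqVneq.
    apply: (isolated_delete xyH) => -[p1 p2] pG; rewrite !inE /=.
    have /isolated_bedgeP[_ + _] := xyH; rewrite !inE /= => /and3P[xyG xv yv].
    move: tri => /and4P[_ wv vw' w'w].
    move/partial_injectiveP: inj => inj.
    have [/= i1 i2] := inj _ _ pG vw'.
    have [/= i3 i4] := inj _ _ pG wv.
    have [/= i5 i6] := inj _ _ xyG vw'.
    have [/= i7 i8] := inj _ _ xyG wv.
    have [/= i9 i10] := inj _ _ xyG w'w.
    (* A deleted edge is [(v, w')] or [(w, v)]. If it touches [(x, y)] at [w'], then [w' = x] forces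
       [(x, y) = (w', w)], while [w' = y] forces [x = v], which was deleted; contact at [w] is
       symmetric. *)
    case/orP => /eqP e.
      have e2 := i1 e; rewrite e e2 !(eq_sym v) !(negPf xv) !(negPf yv) /=.
      case/orP => /eqP e3.
        by move: xyE; rewrite -e3 i9 -?e3 ?eqxx.
      by move: xv; rewrite i6 ?eqxx.
    have e2 := i4 e; rewrite e e2 !(eq_sym v) !(negPf xv) !(negPf yv) /= orbF.
    case/orP => /eqP e3.
      by move: yv; rewrite i7 ?eqxx.
    by move: xyE; rewrite -e3 i10 -?e3 ?eqxx.
  by rewrite cardsU1; apply: leq_add (leq_b1 _) _.
have b2 : #|b_loops (delete [set v] G)| <= #|b_loops G|.
  apply: leq_trans (subset_leq_card (b_loops_delete _ _)) _.
  by rewrite subset_leq_card ?subsetDl.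
have b3 : #|a_loops (delete [set v] G)| < #|a_loops G|.
  by apply: leq_ltn_trans (subset_leq_card (a_loops_delete _ _)) _;
    rewrite [X in _ < X](cardsD1 v) inE va.
have := card_delete [set v] G; rewrite cards1 /weight; lia.
Qed.

Lemma delete_isolated_weight G v w : isolated_bedge G v w ->
  #|b_isolated (delete [set v; w] G)| < #|b_isolated G|.
Proof.
move=> iso; have /isolated_bedgeP[vw vwG cl] := iso.
rewrite (cardsD1 (v, w) (b_isolated G)) inE iso ltnS.
apply/subset_leq_card/subsetP => p pH; rewrite in_setD1 [p \in b_isolated _]inE.
have /isolated_bedgeP[_ + _] : isolated_bedge (delete [set v; w] G) p.1 p.2.
  by move: pH; rewrite inE.
rewrite inE => /and3P[_ pv _]; apply/andP; split.
  by apply: contraNneq pv => ->; rewrite set21.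
have := subsetP (@b_isolated_delete [set v; w] G _) p pH; rewrite inE; apply.
by move=> q qG /(cl q qG)->; rewrite /= set21 set22.
Qed.

(** The isolated b-edge pays 2 for the two vertices, and the a-loop lost at [v] makes up for the one
    added at [w']. *)
Lemma lambda22_weight G H : partial_injective G -> lambda22 G H ->
  partial_injective H /\ #|vertices G| + weight H <= #|vertices H| + weight G.
Proof.
move=> inj /exists_inP[v vG /existsP[w /existsP[w' /and5P[va iso _ _ /eqP->]]]].
split; first exact: partial_injective_sub (delete_bedges _ _) inj.
have b1 : #|b_isolated (delete [set v; w] G)| < #|b_isolated G|.
  by case/orP: iso => /delete_isolated_weight; rewrite // setUC.
have b2 : #|b_loops (delete [set v; w] G)| <= #|b_loops G|.
  apply: leq_trans (subset_leq_card (b_loops_delete _ _)) _.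
  by rewrite subset_leq_card ?subsetDl.
have b3 : #|a_loops (add_aedge [set w'] (delete [set v; w] G))| <= #|a_loops G|.
  apply: leq_trans (subset_leq_card (a_loops_add_loop _ _)) _.
  rewrite cardsU1 (cardsD1 v (a_loops G)) [v \in _]inE va.
  apply: leq_add (leq_b1 _) _.
  apply: leq_trans (subset_leq_card (a_loops_delete _ _)) _.
  by apply/subset_leq_card/setDS; rewrite sub1set set21.
have b0 := card_delete [set v; w] G; rewrite cards2 in b0.
set H' := add_aedge _ _.
rewrite -[#|vertices (delete _ _)|]/(#|vertices H'|) in b0.
rewrite -[#|b_isolated (delete _ _)|]/(#|b_isolated H'|) in b1.
rewrite -[#|b_loops (delete _ _)|]/(#|b_loops H'|) in b2.
rewrite -/H' in b3; rewrite /weight; move: (v != w) b0 => []; lia.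
Qed.

(** The isolated b-edge pays 2 for the two vertices; the new a-edge has distinct ends and so is no
    loop. *)
Lemma kappa3_weight G H : partial_injective G -> kappa3 G H ->
  partial_injective H /\ #|vertices G| + weight H <= #|vertices H| + weight G.
Proof.
move=> inj /exists_inP[v vG /existsP[w /existsP[v' /existsP[w']]]].
case/and5P => iso _ _ vw /eqP->.
split; first exact: partial_injective_sub (delete_bedges _ _) inj.
have b1 := delete_isolated_weight iso.
have b2 : #|b_loops (delete [set v; w] G)| <= #|b_loops G|.
  apply: leq_trans (subset_leq_card (b_loops_delete _ _)) _.
  by rewrite subset_leq_card ?subsetDl.
have b3 : #|a_loops (add_aedge [set v'; w'] (delete [set v; w] G))| <= #|a_loops G|.
  have vw' : v' != w' by move: vw; rewrite /= !inE => /and4P[_ _ ].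
  apply: leq_trans (subset_leq_card (a_loops_add_edge _ vw')) _.
  apply: leq_trans (subset_leq_card (a_loops_delete _ _)) _.
  by rewrite subset_leq_card ?subsetDl.
have b0 := card_delete [set v; w] G; rewrite cards2 in b0.
set H' := add_aedge _ _.
rewrite -[#|vertices (delete _ _)|]/(#|vertices H'|) in b0.
rewrite -[#|b_isolated (delete _ _)|]/(#|b_isolated H'|) in b1.
rewrite -[#|b_loops (delete _ _)|]/(#|b_loops H'|) in b2.
rewrite -/H' in b3; rewrite /weight; move: (v != w) b0 => []; lia.
Qed.

(** The weight drops from at least 2 + 6 = 8 to 3 + 4 = 7, which pays for one vertex. *)
Lemma exc_weight G H : exc G H ->
  partial_injective H /\ #|vertices G| + weight H <= #|vertices H| + weight G.
Proof.
case/existsP => v /existsP[w /and3P[vw /eqP-> /eqP->]]; split.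
  by apply/partial_injectiveP => p q; rewrite !inE => /eqP-> /eqP->.
have a1 : a_loops (Delta1 v) = [set v].
  by apply/setP => x; rewrite !inE /aloop /= inE (inj_eq set1_inj).
have a3 : a_loops (Delta3 v w) = [set v; w].
  by apply/setP => x; rewrite !inE /aloop /= !inE !(inj_eq set1_inj).
have b1 : b_loops (Delta1 v) = [set v].
  by apply/setP => x; rewrite !inE /bloop /= inE xpair_eqE andbb.
have i1 : b_isolated (Delta1 v) = set0.
  apply/setP => -[x y]; rewrite !inE /=; apply/isolated_bedgeP => -[xy + _].
  by rewrite inE => /eqP[xv yv]; rewrite xv yv eqxx in xy.
have i3 : (v, w) \in b_isolated (Delta3 v w).
  rewrite inE; apply/isolated_bedgeP; split=> //=; first by rewrite inE.
  by move=> p; rewrite inE => /eqP.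
have : 0 < #|b_isolated (Delta3 v w)| by apply/card_gt0P; exists (v, w).
have v1 : #|vertices (Delta1 v)| = 1 by rewrite cards1.
have v3 : #|vertices (Delta3 v w)| = 2 by rewrite cards2 vw.
rewrite /weight v1 v3 a1 a3 b1 i1 cards0 cards2 cards1 vw; lia.
Qed.

(** Partial injectivity is returned along with the inequality so that the argument can be iterated
    over a sequence of moves. *)
Lemma move_weight G H : partial_injective G -> move G H ->
  partial_injective H /\ #|vertices G| + weight H <= #|vertices H| + weight G.
Proof.
move=> inj /or4P[|||/orP[]].
- exact: lambda3_weight.
- exact: lambda21_weight.
- exact: lambda22_weight.
- exact: kappa3_weight.
- exact: exc_weight.
Qed.

Lemma connect_move_weight G H : partial_injective G -> connect (@move T) G H ->
  #|vertices G| <= #|vertices H| + weight G.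
Proof.
move=> + /connectP[s + ->]; elim: s G => [|K s IHs] G inj /=.
  by move=> _; rewrite leq_addr.
case/andP => GK /IHs sK; have [injK le] := move_weight inj GK.
rewrite -(leq_add2r (weight K)); apply: leq_trans le _.
by rewrite addnAC leq_add2r; apply: sK.
Qed.

End Moves.

Lemma silh_size_weight (n : nat) (G : graph 'I_n) : G \in labeled_graphs n ->
  n <= silh_size G + weight G.
Proof.
rewrite inE => /andP[/eqP GT /and4P[_ _ _ /and3P[inj _ _]]].
have /andP[GH _] := reductP G.
have := connect_move_weight inj GH; rewrite GT cardsT card_ord.
by rewrite /silh_size /silh /= cardsT card_ord.
Qed.

(** * Labeled graphs *)

Section Structures.
Variable T : finType.
Implicit Types (G : graph T) (v w x y : T) (S : {set T}).

Definition a_covers S := exact_covers (@id {set T}) (a_pieces T) S.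
Definition b_covers S := exact_covers (@b_verts T) (b_pieces T) S.

Definition structures S : {set {set {set T}} * {set {set T * T}}} :=
  setX (a_covers S) (b_covers S).

(** Two injections are used: [structure_of] carries upper bounds for sums over graphs to sums over
    all pairs, and [graph_of], defined for disconnected pairs too, bounds the number of graphs from
    below. *)
Definition structure_of G := (aedges G, pieces_of (bedges G)).
Definition graph_of (s : {set {set T}} * {set {set T * T}}) : graph T :=
  Graph setT s.1 (cover s.2).

Lemma a_covers_condition G : vertices G = setT ->
  (aedges G \in a_covers setT) =
  [forall e in aedges G, (e \subset vertices G) && (0 < #|e| <= 2)]
    && a_condition G.
Proof.
move=> GT; rewrite /a_condition GT.
apply/exact_coversP/andP => [[EK _ Ed Ec]|[/forall_inP E2 /forall_inP E1]].
  split; apply/forall_inP.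
    by move=> e /(subsetP EK); rewrite !inE subsetT.
  move=> v vT; have [e eE ve] := Ec v vT; apply/cards1P; exists e.
  apply/setP => f; rewrite !inE; apply/andP/eqP => [[fE vf]|->//].
  exact: Ed vf ve.
split.
- by apply/subsetP => e /E2/andP[_ e2]; rewrite inE.
- by move=> e _; apply: subsetT.
- move=> e f v eE fE ve vf.
  have /cards1P[g /setP gE] : #|[set e in aedges G | v \in e]| == 1 by apply: E1.
  have := gE e; have := gE f; rewrite !inE eE fE ve vf /=.
  by move=> /esym/eqP-> /esym/eqP->.
- move=> v vT; have /cards1P[g /setP/(_ g)] := E1 v vT.
  by rewrite !inE eqxx => /andP[gE vg]; exists g.
Qed.

Lemma structure_of_in G : vertices G = setT -> cyclically_reduced G ->
  structure_of G \in structures setT.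
Proof.
move=> GT /and4P[/andP[wfa _] _ ac bc]; apply/setXP; split.
  by rewrite a_covers_condition // wfa.
exact: pieces_of_exact.
Qed.

Lemma structure_of_inj :
  {in [pred G | (vertices G == setT) && cyclically_reduced G] &,
    injective structure_of}.
Proof.
move=> G H /andP[/eqP GT cG] /andP[/eqP HT cH] [eA eB].
have cover_eq (K : graph T) : vertices K = setT -> cyclically_reduced K ->
    cover (pieces_of (bedges K)) = bedges K.
  by move=> KT /and4P[_ _ _ bK]; apply/cover_pieces_of/pieces_of_exact.
have := cover_eq G GT cG; rewrite eB cover_eq //.
by case: G H GT HT eA {cG cH eB} => [? ? ?] [? ? ?] /= -> -> -> ->.
Qed.

Lemma graph_of_inj : {in structures setT &, injective graph_of}.
Proof.
move=> [a p] [b q] /setXP[_ pB] /setXP[_ qB] [/= -> pq].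
by rewrite -(pieces_of_cover pB) pq pieces_of_cover.
Qed.

(** Every requirement except connectedness is built into the pair. *)
Lemma graph_of_reduced s : s \in structures setT ->
  cyclically_reduced (graph_of s) = connected_graph (graph_of s).
Proof.
case: s => [a p] /setXP[aA pB]; rewrite /cyclically_reduced /well_formed.
have := a_covers_condition (G := graph_of (a, p)) erefl; rewrite aA.
case/esym/andP => -> ->.
have -> : b_condition (graph_of (a, p)).
  by apply: b_condition_cover; rewrite //= pieces_of_cover.
rewrite !andbT; have -> //= : [forall p0 in bedges (graph_of (a, p)),
  (p0.1 \in vertices (graph_of (a, p))) && (p0.2 \in vertices (graph_of (a, p)))].
by apply/forall_inP => q _; rewrite !inE.
Qed.

Definition split_structures S : {set {set {set T}} * {set {set T * T}}} :=
  setX [set E in a_covers setT | [forall e in E, (e \subset S) || (e \subset ~: S)]]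
       [set P in b_covers setT | [forall c in P,
          (b_verts c \subset S) || (b_verts c \subset ~: S)]].

Lemma card_structures S : #|structures S| = num_a #|S| * num_b #|S|.
Proof. by rewrite cardsX card_a_covers card_b_covers. Qed.

Lemma card_split_structures S :
  #|split_structures S| <= #|structures S| * #|structures (~: S)|.
Proof.
rewrite !cardsX mulnACA; apply: leq_mul.
  exact: card_split_exact_covers.
exact: card_split_exact_covers.
Qed.

Lemma disconnected_split s : s \in structures setT -> 0 < #|T| ->
    ~~ connected_graph (graph_of s) ->
  exists S, [/\ S != set0, S != setT & s \in split_structures S].
Proof.
case: s => [a p] /setXP[aA pB] /card_gt0P[v0 _]; set G := graph_of _.
rewrite negb_and; have -> : vertices G != set0 by apply/set0Pn; exists v0; rewrite inE.
case/forall_inPn => v _ /forall_inPn[w _ vw].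
(* The splitting set is the component of [v]. The vertices of any piece are joined through its
   edges, so no piece straddles it. *)
pose S := [set x | connect (adjacent G) v x].
have adjS x y : x \in S -> adjacent G x y -> y \in S.
  by rewrite !inE => vx xy; apply: connect_trans vx (connect1 xy).
exists S; split.
- by apply/set0Pn; exists v; rewrite inE connect0.
- by apply: contraNneq vw => ST; have := in_setT w; rewrite -ST inE.
have split_of (D : {set T}) :
    (forall x y, x \in D -> y \in D -> x \in S -> y \in S) ->
    (D \subset S) || (D \subset ~: S).
  move=> cl; have [//|/subsetPn[x xD xS]] := boolP (D \subset S).
  apply/subsetP => y yD; rewrite inE; apply: contra xS; exact: cl.
apply/setXP; split; rewrite inE ?aA ?pB; apply/forall_inP; [move=> e ea|move=> c cp].
  apply: split_of => x y xe ye xS.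
  have [<-//|xy] := eqVneq x y.
  apply: (adjS x) => //; apply/orP; left; rewrite /=.
  have [/subsetP/(_ e ea) + _ _ _] := exact_coversP _ _ _ _ aA.
  rewrite inE => /andP[_ e2].
  suff /eqP -> : [set x; y] == e by [].
  by rewrite eqEcard subUset !sub1set xe ye cards2 xy.
have cK : c \in b_pieces T by case/exact_coversP: pB => /subsetP/(_ c cp).
have ends q : q \in c -> (q.1 \in S) = (q.2 \in S).
  move=> qc; have qG : q \in bedges G by apply/bigcupP; exists c.
  by apply/idP/idP => /adjS; apply; rewrite /adjacent -surjective_pairing qG !orbT.
apply: split_of => x y /b_vertsP[q qc xq] /b_vertsP[r rc yr].
have -> : (x \in S) = (q.1 \in S) by case/orP: xq => /eqP->; rewrite ?ends.
have -> : (y \in S) = (r.1 \in S) by case/orP: yr => /eqP->; rewrite ?ends.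
have := piece_edges_meet cK qc rc; rewrite !in_set2 (ends r rc).
have rr := ends r rc; have qq := ends q qc.
by case/orP => /orP[] /eqP e; rewrite -?rr ?e ?qq // -?qq // ?rr e -?qq.
Qed.

End Structures.

Lemma card_sets_sum n (f : nat -> nat) :
  \sum_(S : {set 'I_n} | (S != set0) && (S != setT)) f #|S| =
  \sum_(1 <= k < n) 'C(n, k) * f k.
Proof.
rewrite (eq_bigl (fun S : {set 'I_n} => (0 < #|S|) && (#|S| < n))); last first.
  move=> S; rewrite card_gt0; case: eqVneq => //= _.
  by have := properEneq S setT; rewrite properEcard subsetT cardsT card_ord andbT.
rewrite (partition_big (fun S : {set 'I_n} => inord #|S| : 'I_n.+1)
   (fun k : 'I_n.+1 => (0 < k) && (k < n))) /=; last first.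
  by move=> S /andP[S0 Sn]; rewrite inordK ?S0 ?Sn // ltnS ltnW.
rewrite big_nat_cond [RHS](big_nat_widen _ _ n.+1) //.
rewrite [RHS](big_nat_widenl 1 0) // big_mkord.
apply: eq_big => [k|k]; first by rewrite -!andbA; case: (0 < k); case: (k < n).
move=> /andP[k0 kn].
rewrite (eq_bigl (fun S : {set 'I_n} => #|S| == k)); last first.
  move=> S; have [Sk|Sk] := eqVneq #|S| k.
    by rewrite Sk k0 kn; apply/eqP/val_inj; rewrite /= inordK.
  apply/negP => /andP[/andP[S0 Sn] /eqP/(congr1 val) /=].
  by rewrite inordK ?ltnS 1?ltnW // => /eqP; apply/negP.
rewrite (eq_bigr (fun=> f k)) => [|S /eqP-> //].
rewrite sum_nat_const; congr (_ * _).
rewrite -[n in 'C(n, _)](card_ord n) -card_draws.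
by apply: eq_card => S; rewrite inE.
Qed.

Lemma leq_card_bigcup (I U : finType) (P : pred I) (F : I -> {set U}) :
  #|\bigcup_(i | P i) F i| <= \sum_(i | P i) #|F i|.
Proof.
elim/big_rec2: _ => [|i m A _ leAm]; first by rewrite cards0.
by apply: leq_trans (leq_card_setU _ _) _; rewrite leq_add2l.
Qed.

Lemma leq_ffact2r j m n : m <= n -> m ^_ j <= n ^_ j.
Proof.
elim: j m n => // j IHj m n lemn; rewrite !ffactnS leq_mul // IHj //.
by rewrite -!subn1 leq_sub2r.
Qed.

Lemma sum_setX (U V : finType) (A : {set U}) (B : {set V}) (F : U -> V -> nat) :
  \sum_(s in setX A B) F s.1 s.2 = \sum_(a in A) \sum_(b in B) F a b.
Proof. by rewrite pair_big; apply: eq_bigl => s; rewrite inE. Qed.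

Section LabeledGraphs.
Variable n : nat.
Hypothesis n_gt0 : 0 < n.
Local Notation T := 'I_n.

(** A pair is either connected, hence a labeled graph, or split along a proper nonempty vertex set;
    the latter pairs are counted by a union bound over that set. *)
Lemma labeled_graphs_lower :
  num_a n * num_b n <= #|labeled_graphs n| +
    \sum_(1 <= k < n) 'C(n, k) *
      (num_a k * num_b k * (num_a (n - k) * num_b (n - k))).
Proof.
pose conn := [set s in structures [set: T] | connected_graph (graph_of s)].
have WE : #|structures [set: T]| = num_a n * num_b n.
  by rewrite card_structures cardsT card_ord.
rewrite -WE -(cardsID conn); apply: leq_add.
  rewrite -(card_in_imset (f := @graph_of T)).
    apply/subset_leq_card/subsetP => G /imsetP[s /setIP[sS]].
    rewrite inE => /andP[_ sc] ->; rewrite inE eqxx /=.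
    by rewrite graph_of_reduced.
  by move=> s t /setIP[sS _] /setIP[tS _]; apply: graph_of_inj.
rewrite -(card_sets_sum n
  (fun k => num_a k * num_b k * (num_a (n - k) * num_b (n - k)))).
apply: (@leq_trans #|\bigcup_(S : {set T} | (S != set0) && (S != setT))
                        split_structures S|).
  apply/subset_leq_card/subsetP => s /setDP[sS]; rewrite inE sS /= => sN.
  have [|S [S0 ST sSp]] := disconnected_split sS _ sN; first by rewrite card_ord.
  by apply/bigcupP; exists S; rewrite ?S0.
apply: leq_trans (leq_card_bigcup _ _) _.
apply: leq_sum => S _; apply: leq_trans (card_split_structures S) _.
by rewrite !card_structures [#|~: S|]cardsCs setCK card_ord.
Qed.

(** By injectivity the right-hand sum contains the sum over the image of the graphs; the
    disconnected pairs only add to it. *)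
Lemma sum_labeled_graphs_le (f : graph T -> nat)
    (g : {set {set T}} * {set {set T * T}} -> nat) :
    (forall G, G \in labeled_graphs n -> f G <= g (structure_of G)) ->
  \sum_(G in labeled_graphs n) f G <= \sum_(s in structures [set: T]) g s.
Proof.
move=> fg; apply: (@leq_trans (\sum_(G in labeled_graphs n) g (structure_of G))).
  exact: leq_sum.
have inj : {in labeled_graphs n &, injective (@structure_of T)}.
  by move=> G H; rewrite !inE => Gl Hl; apply: structure_of_inj; rewrite inE.
rewrite -(big_imset g inj) /=.
rewrite [X in _ <= X](bigID [in [set structure_of x | x in labeled_graphs n]]) /=.
apply: leq_trans (leq_addr _ _); apply/eq_leq/eq_bigl => s.
apply/idP/andP => [|[]//]; move=> sI; split=> //.
case/imsetP: sI => G; rewrite inE => /andP[/eqP GT cG] ->.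
exact: structure_of_in.
Qed.

(** The bound concerns the a-structure alone, so the independent b-structure contributes the factor
    [num_b n]. The next two lemmas exchange the roles. *)
Lemma sum_labeled_graphs_a_loops j :
  \sum_(G in labeled_graphs n) #|a_loops G| ^_ j <= moment num_a id 1 j n * num_b n.
Proof.
apply: leq_trans (sum_labeled_graphs_le
  (g := fun s => #|s.1 :&: a_loop_pieces T| ^_ j) _) _.
  move=> G _; apply: leq_ffact2r.
  rewrite -(card_imset _ (@set1_inj _)); apply/subset_leq_card/subsetP.
  by move=> e /imsetP[v + ->]; rewrite !inE /= cards1 eqxx andbT.
rewrite (sum_setX _ _ (fun E _ => #|E :&: a_loop_pieces T| ^_ j)).
under eq_bigr do rewrite sum_nat_const.
rewrite -big_distrr /= mulnC /a_covers /b_covers moment_a_loops card_b_covers.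
by rewrite cardsT card_ord.
Qed.

Lemma sum_labeled_graphs_b_loops j :
  \sum_(G in labeled_graphs n) #|b_loops G| ^_ j <= num_a n * moment num_b id 1 j n.
Proof.
apply: leq_trans (sum_labeled_graphs_le
  (g := fun s => #|s.2 :&: b_loop_pieces T| ^_ j) _) _.
  move=> G; rewrite inE => /andP[_ /and4P[_ _ _ /and3P[inj _ _]]].
  apply: leq_ffact2r.
  rewrite -(card_imset (f := fun v => [set (v, v)])) => [|v w /set1_inj[]//].
  apply/subset_leq_card/subsetP => c /imsetP[v + ->]; rewrite inE => vG.
  by rewrite in_setI loop_piece_of // imset_f.
rewrite (sum_setX _ _ (fun _ P => #|P :&: b_loop_pieces T| ^_ j)) sum_nat_const.
rewrite /a_covers /b_covers moment_b_loops card_a_covers.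
by rewrite cardsT card_ord.
Qed.

Lemma sum_labeled_graphs_b_isolated j :
  \sum_(G in labeled_graphs n) #|b_isolated G| ^_ j <=
    num_a n * moment num_b (fun m => m * m.-1) 2 j n.
Proof.
apply: leq_trans (sum_labeled_graphs_le
  (g := fun s => #|s.2 :&: b_edge_pieces T| ^_ j) _) _.
  move=> G _; apply: leq_ffact2r.
  rewrite -(card_imset _ (@set1_inj _)); apply/subset_leq_card/subsetP.
  move=> c /imsetP[[v w] + ->]; rewrite inE => iso.
  rewrite in_setI edge_piece_of //; apply/imsetP; exists (v, w) => //.
  by case/and3P: iso; rewrite inE.
rewrite (sum_setX _ _ (fun _ P => #|P :&: b_edge_pieces T| ^_ j)) sum_nat_const.
rewrite /a_covers /b_covers moment_b_edges card_a_covers.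
by rewrite cardsT card_ord.
Qed.

End LabeledGraphs.

(** * Variance inequality for the number of loops *)

Lemma sum_sqr_le (I : finType) (A : {set I}) (x : I -> nat) :
  (\sum_(i in A) x i) ^ 2 <= #|A| * \sum_(i in A) x i ^ 2.
Proof.
(* After doubling, the claim is the sum of 2ab <= a^2 + b^2 over all pairs of indices. *)
rewrite -(leq_pmul2l (isT : 0 < 2)) -mulnn big_distrlr /= big_distrr /=.
apply: (@leq_trans (\sum_(i in A) \sum_(j in A) (x i ^ 2 + x j ^ 2))).
  apply: leq_sum => i _; rewrite big_distrr /=; apply: leq_sum => j _.
  exact: nat_Cauchy.
under eq_bigr do rewrite big_split /= sum_nat_const.
by rewrite big_split /= -big_distrr /= sum_nat_const addnn -mul2n.
Qed.

(* Nonnegativity of the variance, in terms of factorial moments. *)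
Lemma ffact_moments_sqr_le (I : finType) (A : {set I}) (x : I -> nat) :
  (\sum_(i in A) x i ^_ 1) ^ 2 <=
  #|A| * (\sum_(i in A) x i ^_ 2 + \sum_(i in A) x i ^_ 1).
Proof.
have -> : \sum_(i in A) x i ^_ 1 = \sum_(i in A) x i.
  by apply: eq_bigr => i _; rewrite ffactn1.
apply: leq_trans (sum_sqr_le A x) _; rewrite leq_mul2l -big_split /=.
apply/orP; right; apply: leq_sum => i _.
by rewrite !ffactnS ffactn0; case: (x i) => //= m; nia.
Qed.

(** The number of a-loops has first and second factorial moments [n * num_a n.-1] and
    [n * n.-1 * num_a n.-2], up to the total count; its variance is nonnegative. *)
Lemma num_a_jensen n : (n * num_a n.-1) ^ 2 <=
  num_a n * (n * n.-1 * num_a n.-2 + n * num_a n.-1).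
Proof.
have := ffact_moments_sqr_le (exact_covers id (a_pieces 'I_n) setT)
  (fun P => #|P :&: a_loop_pieces 'I_n|).
by rewrite !moment_a_loops card_a_covers cardsT card_ord /= !subn1 mulnA.
Qed.

Lemma num_b_jensen n : (n * num_b n.-1) ^ 2 <=
  num_b n * (n * n.-1 * num_b n.-2 + n * num_b n.-1).
Proof.
have := ffact_moments_sqr_le (exact_covers (@b_verts _) (b_pieces 'I_n) setT)
  (fun P => #|P :&: b_loop_pieces 'I_n|).
by rewrite !moment_b_loops card_b_covers cardsT card_ord /= !subn1 mulnA.
Qed.

Lemma num_a_gt0 n : 0 < num_a n.
Proof.
have: 0 < num_a n /\ 0 < num_a n.+1.
  elim: n => [//|n [n0 n1]]; split=> //.
  by rewrite num_aSS addn_gt0 n1.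
by case.
Qed.

Lemma num_b_gt0 n : 0 < num_b n.
Proof.
have: [/\ 0 < num_b n, 0 < num_b n.+1 & 0 < num_b n.+2].
  elim: n => [//|n [n0 n1 n2]]; split=> //.
  by rewrite num_bSSS -addnA addn_gt0 n2.
by case.
Qed.

Import Order.TTheory GRing.Theory Num.Theory.
Local Open Scope ring_scope.

(** * Asymptotics *)

Lemma num_a_rec n : num_a n.+1 = (num_a n + n * num_a n.-1)%N.
Proof. by case: n. Qed.

Lemma num_b_rec n :
  num_b n.+1 = (num_b n + 2 * n * num_b n.-1 + n * n.-1 * num_b n.-2)%N.
Proof. by case: n => [|[|n]]. Qed.

Section Tau.
Variable R : realFieldType.
Implicit Types (num : nat -> nat) (n : nat).

(** For [num_a] and [num_b] this is the mean number of loops of a uniformly random structure on [n]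
    vertices. *)
Definition tau num n : R := n%:R * (num n.-1)%:R / (num n)%:R.
Notation tau_a := (tau num_a).
Notation tau_b := (tau num_b).

Lemma num_a_gt0R n : 0 < (num_a n)%:R :> R.
Proof. by rewrite ltr0n num_a_gt0. Qed.

Lemma num_b_gt0R n : 0 < (num_b n)%:R :> R.
Proof. by rewrite ltr0n num_b_gt0. Qed.

Lemma tau_ge0 num n : 0 <= tau num n.
Proof. by rewrite divr_ge0 // mulr_ge0. Qed.

Lemma tau_a_gt0 n : (0 < n)%N -> 0 < tau_a n.
Proof.
by move=> n0; rewrite divr_gt0 ?mulr_gt0 ?num_a_gt0R // ltr0n.
Qed.

Lemma tau_b_gt0 n : (0 < n)%N -> 0 < tau_b n.
Proof.
by move=> n0; rewrite divr_gt0 ?mulr_gt0 ?num_b_gt0R // ltr0n.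
Qed.

(** In terms of ratios the second factorial moment is tau_{n+1} tau_n, so the hypothesis reads
    tau_{n+1}^2 <= tau_{n+1} (tau_n + 1). *)
Lemma jensen_tau num n : (forall m, (0 < num m)%N) ->
  ((n.+1 * num n) ^ 2 <= num n.+1 * (n.+1 * n * num n.-1 + n.+1 * num n))%N ->
  tau num n.+1 <= tau num n + 1.
Proof.
move=> num_gt0 J; rewrite /tau /=.
have a0 : 0 < (num n.+1)%:R :> R by rewrite ltr0n.
have b0 : 0 < (num n)%:R :> R by rewrite ltr0n.
have n0 : 0 < n.+1%:R :> R by rewrite ltr0n.
have {J} J : (n.+1%:R * (num n)%:R) ^+ 2 <= (num n.+1)%:R *
    (n.+1%:R * n%:R * (num n.-1)%:R + n.+1%:R * (num n)%:R) :> R.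
  by rewrite -!natrM -natrD -natrX -natrM ler_nat.
rewrite ler_pdivrMr // mulrDl mul1r.
rewrite -(ler_pM2l (mulr_gt0 n0 b0)) -expr2; apply: le_trans J _.
rewrite le_eqVlt; apply/orP; left; apply/eqP.
by field; rewrite gt_eqF.
Qed.

Lemma tau_a_jensen n : tau_a n.+1 <= tau_a n + 1.
Proof. by apply: jensen_tau (num_a_jensen _) => m; apply: num_a_gt0. Qed.

Lemma tau_b_jensen n : tau_b n.+1 <= tau_b n + 1.
Proof. by apply: jensen_tau (num_b_jensen _) => m; apply: num_b_gt0. Qed.

(** Dividing the recurrence by [num_a n] gives 1 + tau_n for the quotient of consecutive counts, and
    n+1 is tau_{n+1} times this quotient. *)
Lemma tau_a_rec n : n.+1%:R = tau_a n.+1 * (1 + tau_a n).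
Proof.
have a0 := num_a_gt0R n; have a1 := num_a_gt0R n.+1.
rewrite /tau /=.
have E : (num_a n.+1)%:R = (num_a n)%:R + n%:R * (num_a n.-1)%:R :> R.
  by rewrite num_a_rec natrD natrM.
transitivity (n.+1%:R / (num_a n.+1)%:R * ((num_a n)%:R + n%:R * (num_a n.-1)%:R) : R).
  by rewrite -E divfK // gt_eqF.
by field; rewrite !gt_eqF.
Qed.

Lemma tau_b_rec n :
  n.+1%:R = tau_b n.+1 * (1 + 2 * tau_b n + tau_b n * tau_b n.-1).
Proof.
have b0 := num_b_gt0R n; have b1 := num_b_gt0R n.+1; have b2 := num_b_gt0R n.-1.
rewrite /tau /=.
have E : (num_b n.+1)%:R = (num_b n)%:R + 2 * n%:R * (num_b n.-1)%:R +
    n%:R * n.-1%:R * (num_b n.-2)%:R :> R.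
  by rewrite num_b_rec !natrD !natrM.
transitivity (n.+1%:R / (num_b n.+1)%:R * ((num_b n)%:R + 2 * n%:R * (num_b n.-1)%:R +
    n%:R * n.-1%:R * (num_b n.-2)%:R) : R).
  by rewrite -E divfK // gt_eqF.
by field; rewrite !gt_eqF.
Qed.

(** If tau_n > s, then tau_{n-1} >= tau_n - 1 turns the recurrence into n >= tau_n^2 > s^2. *)
Lemma tau_a_le n (s : R) : 0 <= s -> n%:R <= s ^+ 2 -> tau_a n <= s.
Proof.
case: n => [|n] s0 sn; first by rewrite /tau !mul0r.
rewrite leNgt; apply/negP => lt.
have := tau_a_rec n; have := tau_a_jensen n.
have t0 := @tau_a_gt0 n.+1 isT; move: sn lt t0.
set x := tau_a _; set z := tau_a _; move: n.+1%:R => N; nra.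
Qed.

(* If tau_n > t + 1, then tau_{n-1} >= tau_n - 1 and tau_{n-2} >= tau_n - 2 turn
   the recurrence into n >= (tau_n - 1)^3 > t^3. *)
Lemma tau_b_le n (t : R) : 1 <= t -> n%:R <= t ^+ 3 -> tau_b n <= t + 1.
Proof.
case: n => [|n] t1 tn; first by rewrite /tau !mul0r; lra.
rewrite leNgt; apply/negP => lt.
have E := tau_b_rec n; have J1 := tau_b_jensen n.
have J2 : tau_b n <= tau_b n.-1 + 1.
  case: n {E J1 tn lt} => [|n]; last exact: tau_b_jensen.
  by rewrite /tau !mul0r; lra.
move: E J1 J2 tn lt.
set x := tau_b _; set z := tau_b _; set w := tau_b _; move: n.+1%:R => N E J1 J2 tn lt.
have h1 : (x - 1) * (x - 2) <= z * w by apply: ler_pM; lra.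
have h2 : x * (1 + 2 * (x - 1) + (x - 1) * (x - 2)) <= N.
  by rewrite E; apply: ler_wpM2l; lra.
have h3 : t ^+ 3 < (x - 1) ^+ 3 by apply: ltrXn2r => //; lra.
have h4 : (x - 1) ^+ 3 <= x * (1 + 2 * (x - 1) + (x - 1) * (x - 2)).
  rewrite -subr_ge0.
  have -> : x * (1 + 2 * (x - 1) + (x - 1) * (x - 2)) - (x - 1) ^+ 3 =
    2 * x * (x - 1) + 1 by ring.
  nra.
lra.
Qed.

Lemma tau_a_ge n (s : R) : 0 <= s -> n.+1%:R = s ^+ 2 ->
  n.+1%:R / (1 + s) <= tau_a n.+1.
Proof.
move=> s0 sn; rewrite ler_pdivrMr; last by lra.
rewrite {1}(tau_a_rec n) ler_wpM2l ?tau_ge0 // lerD2l.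
by apply: tau_a_le => //; rewrite -sn ler_nat.
Qed.

(** The upper bound t + 1 is fed back into the recurrence, where 1 + 2(t+1) + (t+1)^2 = (t+2)^2. *)
Lemma tau_b_ge n (t : R) : 1 <= t -> n.+1%:R = t ^+ 3 ->
  n.+1%:R / (t + 2) ^+ 2 <= tau_b n.+1.
Proof.
move=> t1 tn; rewrite ler_pdivrMr; last by rewrite exprn_gt0 //; lra.
rewrite {1}(tau_b_rec n) ler_wpM2l ?tau_ge0 //.
have h1 : tau_b n <= t + 1 by apply: tau_b_le => //; rewrite -tn ler_nat.
have h2 : tau_b n.-1 <= t + 1.
  by apply: tau_b_le => //; rewrite -tn ler_nat leqW // leq_pred.
have h3 : tau_b n * tau_b n.-1 <= (t + 1) * (t + 1).
  by apply: ler_pM; rewrite ?tau_ge0.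
nra.
Qed.

(** Each deletion of a piece costs a factor at most [x]. The hypothesis covers all sizes up to [N]
    because successive deletions shrink the structure. *)
Lemma moment_le num (g : nat -> nat) (d : nat) (x : R) N : 0 <= x ->
    (forall m, (m <= N)%N -> (g m * num (m - d))%N%:R <= x * (num m)%:R) ->
  forall j n, (n <= N)%N -> (moment num g d j n)%:R <= x ^+ j * (num n)%:R.
Proof.
move=> x0 H; elim=> [|j IHj] n nN /=; first by rewrite mul1r.
rewrite natrM; apply: (@le_trans _ _ (x ^+ j * (g n * num (n - d))%N%:R)).
  rewrite natrM mulrCA; apply: ler_wpM2l => //; apply: IHj.
  by apply: leq_trans nN; apply: leq_subr.
by rewrite exprSr -mulrA; apply: ler_wpM2l; rewrite ?exprn_ge0 ?H.
Qed.

Lemma moment_a_loops_le n j (s : R) : 0 <= s -> n%:R <= s ^+ 2 ->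
  (moment num_a id 1 j n)%:R <= s ^+ j * (num_a n)%:R.
Proof.
move=> s0 sn; apply: (moment_le (N := n)) => // m mn.
rewrite -ler_pdivrMr ?num_a_gt0R // natrM subn1.
by apply: tau_a_le => //; apply: le_trans sn; rewrite ler_nat.
Qed.

Lemma moment_b_loops_le n j (t : R) : 1 <= t -> n%:R <= t ^+ 3 ->
  (moment num_b id 1 j n)%:R <= (t + 1) ^+ j * (num_b n)%:R.
Proof.
move=> t1 tn; apply: (moment_le (N := n)) => // [|m mn]; first by lra.
rewrite -ler_pdivrMr ?num_b_gt0R // natrM subn1.
by apply: tau_b_le => //; apply: le_trans tn; rewrite ler_nat.
Qed.

Lemma moment_b_isolated_le n j (t : R) : 1 <= t -> n%:R <= t ^+ 3 ->
  (moment num_b (fun m => m * m.-1)%N 2 j n)%:R <=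
    ((t + 1) ^+ 2) ^+ j * (num_b n)%:R.
Proof.
move=> t1 tn; apply: (moment_le (N := n)) => // [|m mn].
  by rewrite exprn_ge0 //; lra.
have h m' : (m' <= m)%N -> tau_b m' <= t + 1.
  move=> mm; apply: tau_b_le => //; apply: le_trans tn.
  by rewrite ler_nat (leq_trans mm).
rewrite -ler_pdivrMr ?num_b_gt0R // expr2.
(* The ratio for deleting an edge, m(m-1) B_{m-2} / B_m, is the product of two consecutive loop
   ratios. *)
apply: (@le_trans _ _ (tau_b m * tau_b m.-1)); last first.
  by apply: ler_pM; rewrite ?tau_ge0 // h // leq_pred.
rewrite /tau subn2 !natrM le_eqVlt; apply/orP; left; apply/eqP.
by field; rewrite !gt_eqF // num_b_gt0R.
Qed.

End Tau.

(** * Convolution squares of sequences with growing ratios *)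

Section Convolution.
Variables (R : realFieldType) (u : nat -> R) (q : R) (i0 : nat).
Hypothesis u0 : u 0 = 1.
Hypothesis u_gt0 : forall n, 0 < u n.
Hypothesis q01 : 0 < q < 1.
Let r n := u n / u n.-1.
Hypothesis r_le : forall i m, (i0 <= i)%N -> (2 * i <= m)%N -> r i <= q * r m.
Hypothesis r_unbounded : forall M, exists N, forall n, (N <= n)%N -> M <= r n.

Lemma ratio_mul n : u n.+1 = r n.+1 * u n.
Proof. by rewrite /r divfK // gt_eqF. Qed.

(* For i <= N, the ratio at i is compared with the one at i + N >= 2 i. *)
Lemma product_decay d : 0 < d ->
  exists N0, forall N i, (N0 <= N)%N -> (0 < i <= N)%N ->
    u i * u N <= d * q ^+ i.-1 * u (i + N).
Proof.
move=> d0; have /andP[q0 q1] := q01.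
(* The first term of [M] produces the factor [d] at [i = 1]; the sum handles the finitely many
   [i < i0] to which [r_le] does not apply. *)
pose M := r 1 / d + \sum_(i < i0) r i / q.
have r0 n : 0 < r n by rewrite divr_gt0.
have [N0 HN0] := r_unbounded M; exists N0 => N i N0N.
have sum_ge0 : 0 <= \sum_(i < i0) r i / q.
  by apply: sumr_ge0 => j _; rewrite divr_ge0 // ltW.
elim: i => [//|[|i] IHi] /andP[_ iN].
  rewrite (ratio_mul 0) u0 mulr1 expr0 mulr1 add1n (ratio_mul N) mulrA.
  apply: ler_wpM2r; first exact: ltW.
  rewrite mulrC -ler_pdivrMr //; apply: le_trans (HN0 N.+1 _); last exact: leqW.
  by rewrite lerDl.
have {}IHi := IHi (ltnW iN).
rewrite (ratio_mul i.+1) addSn (ratio_mul (i.+1 + N)) -mulrA.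
apply: (@le_trans _ _ (r i.+2 * (d * q ^+ i * u (i.+1 + N)))).
  by apply: ler_wpM2l; [exact: ltW | exact: IHi].
suff h : r i.+2 <= q * r (i.+1 + N).+1.
  have -> : d * q ^+ i.+2.-1 * (r (i.+1 + N).+1 * u (i.+1 + N)) =
      (q * r (i.+1 + N).+1) * (d * q ^+ i * u (i.+1 + N)).
    by rewrite /= exprS; ring.
  by apply: ler_wpM2r => //; rewrite ltW // !mulr_gt0 // exprn_gt0.
have [ii0|ii0] := leqP i0 i.+2; first by apply: r_le => //; lia.
rewrite -ler_pdivrMl // mulrC.
apply: le_trans (HN0 _ _); last by lia.
rewrite /M (bigD1 (Ordinal ii0)) //= addrCA lerDl addr_ge0 //.
  by rewrite divr_ge0 // ltW.
by apply: sumr_ge0 => j _; rewrite divr_ge0 // ltW.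
Qed.

Lemma sum_geometric_le n : \sum_(1 <= k < n) q ^+ k.-1 <= (1 - q)^-1.
Proof.
have /andP[q0 q1] := q01; case: n => [|n].
  by rewrite big_geq // invr_ge0; lra.
rewrite big_add1 /= big_mkord -[leRHS]mul1r ler_pdivlMr; last by lra.
have E := subrX1 q n.
have : 0 <= q ^+ n by rewrite exprn_ge0 // ltW.
move: E; set s := \sum_(_ < _) _; lra.
Qed.

Lemma convolution_small e : 0 < e ->
  exists n0, forall n, (n0 <= n)%N ->
    \sum_(1 <= k < n) u k * u (n - k)%N <= e * u n.
Proof.
move=> e0; have /andP[q0 q1] := q01.
(* Two geometric sums, each at most 1/(1-q), will be multiplied by [d]. *)
pose d := e * (1 - q) / 2.
have d0 : 0 < d by rewrite divr_gt0 // mulr_gt0 // subr_gt0.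
have [N0 HN0] := product_decay d0; exists (2 * N0)%N => n n0n.
have q_ge0 k : 0 <= q ^+ k by rewrite exprn_ge0 // ltW.
(* Keeping both powers of [q] in each term avoids cutting the sum in the middle. The larger of [k]
   and [n - k] is at least [N0] as [n >= 2 * N0]. *)
apply: (@le_trans _ _ (\sum_(1 <= k < n) d * (q ^+ k.-1 + q ^+ (n - k).-1) * u n)).
  apply: ler_sum_nat => k /andP[k0 kn].
  have un := ltW (u_gt0 n).
  have [kk|kk] := leqP k (n - k).
    apply: le_trans (HN0 (n - k)%N k _ _) _; [by lia|by rewrite k0|].
    rewrite subnKC ?(ltnW kn) //; apply: ler_wpM2r => //.
    by apply: ler_wpM2l; [exact: ltW | rewrite lerDl].
  rewrite mulrC; apply: le_trans (HN0 k (n - k)%N _ _) _; [by lia|by lia|].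
  rewrite subnK ?(ltnW kn) //; apply: ler_wpM2r => //.
  by apply: ler_wpM2l; [exact: ltW | rewrite lerDr].
rewrite -mulr_suml -mulr_sumr big_split /=; apply: ler_wpM2r; first exact: ltW.
have -> : \sum_(1 <= k < n) q ^+ (n - k).-1 = \sum_(1 <= k < n) q ^+ k.-1.
  rewrite big_nat_rev /=; apply: eq_big_nat => k /andP[k0 kn].
  by congr (q ^+ _); lia.
have h := sum_geometric_le n; apply: (@le_trans _ _ (d * ((1 - q)^-1 + (1 - q)^-1))).
  by apply: ler_wpM2l; [exact: ltW | exact: lerD].
rewrite /d le_eqVlt; apply/orP; left; apply/eqP; field.
by rewrite gt_eqF // subr_gt0.
Qed.

End Convolution.

(** Each of the [j] factors of the falling factorial is at least [a - j]. *)
Lemma subn_exp_le_ffact a j : ((a - j) ^ j <= a ^_ j)%N.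
Proof.
elim: j => // j IHj; rewrite ffactnSr expnSr subnS leq_mul ?leq_pred //.
apply: leq_trans IHj; case: j => // j.
by rewrite leq_exp2r // leq_pred.
Qed.

(** * Tail bounds from factorial moments *)

Section Tails.
Variable R : realFieldType.

(** Markov's inequality for the factorial moment of order [j]: where f >= m, the falling factorial
    is at least (m - j)^j. *)
Lemma ffact_tail (I : finType) (A : {set I}) (f : I -> nat) (x W m q : R) (j : nat) :
    0 <= W -> 0 <= x -> j%:R < m -> x <= q * (m - j%:R) ->
    (\sum_(i in A) f i ^_ j)%N%:R <= x ^+ j * W ->
  #|[set i in A | m <= (f i)%:R]|%:R <= q ^+ j * W.
Proof.
move=> W0 x0 jm xq H; have d0 : 0 < m - j%:R by rewrite subr_gt0.
rewrite -(@ler_pM2r _ ((m - j%:R) ^+ j)) ?exprn_gt0 //.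
apply: (@le_trans _ _ (\sum_(i in A) f i ^_ j)%N%:R); last first.
  apply: le_trans H _; rewrite mulrAC -exprMn ler_wpM2r //.
  by rewrite lerXn2r ?nnegrE // (le_trans x0).
rewrite mulr_natl -sumr_const natr_sum.
rewrite [leRHS](bigID (fun i => m <= (f i)%:R)) /= -[leLHS]addr0.
apply: lerD; last by apply: sumr_ge0.
rewrite (eq_bigl (fun i => (i \in A) && (m <= (f i)%:R))); last first.
  by move=> i; rewrite inE.
apply: ler_sum => i /andP[_ mf].
apply: (@le_trans _ _ ((f i - j) ^ j)%N%:R); last by rewrite ler_nat subn_exp_le_ffact.
have jf : (j <= f i)%N by rewrite -(ler_nat R) ltW // (lt_le_trans jm).
by rewrite natrX natrB // lerXn2r ?nnegrE ?lerD2r ?subr_ge0 ?ler_nat // ltW.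
Qed.

(** With n = y^6, the quantities n^(1/3), n^(1/2) and n^(2/3) are y^2, y^3 and y^4, so the estimates
    become polynomial in [y]. *)
Variables (n : nat) (y : R).
Hypotheses (y1 : 1 <= y) (yK : n%:R = y ^+ 6).
Let W : R := (num_a n * num_b n)%N%:R.

Let W_ge0 : 0 <= W. Proof. exact: ler0n. Qed.
Let y_ge0 : 0 <= y. Proof. exact: le_trans y1. Qed.

Lemma sum_a_loops_le j :
  (\sum_(G in labeled_graphs n) #|a_loops G| ^_ j)%N%:R <= (y ^+ 3) ^+ j * W.
Proof.
apply: (@le_trans _ _ (moment num_a id 1 j n * num_b n)%N%:R).
  by rewrite ler_nat sum_labeled_graphs_a_loops.
rewrite /W !natrM mulrA ler_wpM2r // moment_a_loops_le ?exprn_ge0 //.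
by rewrite yK -exprM.
Qed.

Lemma sum_b_loops_le j :
  (\sum_(G in labeled_graphs n) #|b_loops G| ^_ j)%N%:R <= (y ^+ 2 + 1) ^+ j * W.
Proof.
apply: (@le_trans _ _ (num_a n * moment num_b id 1 j n)%N%:R).
  by rewrite ler_nat sum_labeled_graphs_b_loops.
rewrite /W !natrM mulrCA ler_wpM2l // moment_b_loops_le ?exprn_ege1 //.
by rewrite yK -exprM.
Qed.

Lemma sum_b_isolated_le j :
  (\sum_(G in labeled_graphs n) #|b_isolated G| ^_ j)%N%:R <=
    ((y ^+ 2 + 1) ^+ 2) ^+ j * W.
Proof.
apply: (@le_trans _ _ (num_a n * moment num_b (fun m => m * m.-1) 2 j n)%N%:R).
  by rewrite ler_nat sum_labeled_graphs_b_isolated.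
rewrite /W !natrM mulrCA ler_wpM2l // moment_b_isolated_le ?exprn_ege1 //.
by rewrite yK -exprM.
Qed.

Lemma sum_weight_le :
  (\sum_(G in labeled_graphs n) weight G)%N%:R <=
    (2 * (y ^+ 2 + 1) ^+ 2 + 3 * y ^+ 3 + 4 * (y ^+ 2 + 1)) * W.
Proof.
have := sum_b_isolated_le 1; have := sum_a_loops_le 1; have := sum_b_loops_le 1.
have E (f : graph 'I_n -> nat) :
    (\sum_(G in labeled_graphs n) f G ^_ 1 = \sum_(G in labeled_graphs n) f G)%N.
  by apply: eq_bigr => G _; rewrite ffactn1.
rewrite !E !expr1.
have -> : (\sum_(G in labeled_graphs n) weight G =
    2 * (\sum_(G in labeled_graphs n) #|b_isolated G|) +
    3 * (\sum_(G in labeled_graphs n) #|a_loops G|) +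
    4 * (\sum_(G in labeled_graphs n) #|b_loops G|))%N.
  by rewrite !big_distrr -!big_split.
by rewrite !natrD; move: _%:R _%:R _%:R W => b a i w; lra.
Qed.

(** Since 2(1 + mu/4) + 3 mu/12 + 4 mu/16 = 2 + mu, a large weight forces one of the three counts
    above its own threshold; the factor 3 is the union bound. The lower bound on [y] makes lower
    powers negligible and leaves a factor 1 + mu/8 between mean and threshold. *)
Lemma weight_tail (mu : R) (q : R := (1 + mu / 8)^-1) (j : nat) :
    0 < mu -> y ^+ 2 <= j%:R <= y ^+ 2 + 1 ->
    500 * (1 + mu) <= mu * y ->
  #|[set G in labeled_graphs n | (2 + mu) * y ^+ 4 < (weight G)%:R]|%:R <=
    3 * (q ^+ j * W).
Proof.
move=> mu0 /andP[jge jle] ymu.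
have ymuX k : 500 * (1 + mu) * y ^+ k <= mu * y ^+ k.+1.
  by rewrite exprS (mulrA mu) ler_wpM2r ?exprn_ge0.
have ymu3 := ymuX 2%N; have ymu4 := ymuX 3%N.
have y2 : 1 <= y ^+ 2 by apply: exprn_ege1.
have y4 : 1 <= y ^+ 4 by apply: exprn_ege1.
have y23 : y ^+ 2 <= y ^+ 3 by apply: ler_weXn2l.
have y34 : mu * y ^+ 2 <= mu * y ^+ 3 by apply: ler_wpM2l => //; apply: ltW.
have q0 : 0 < 1 + mu / 8 by rewrite addr_gt0 // divr_gt0.
have tail (f : graph 'I_n -> nat) (m x : R) :
    (\sum_(G in labeled_graphs n) f G ^_ j)%N%:R <= x ^+ j * W -> 0 <= x ->
    (1 + mu / 8) * x <= m - y ^+ 2 - 1 -> 0 < m - y ^+ 2 - 1 ->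
    #|[set G in labeled_graphs n | m <= (f G)%:R]|%:R <= q ^+ j * W.
  move=> H x0 xm m0; apply: ffact_tail H => //; first by lra.
  rewrite /q mulrC ler_pdivlMr // mulrC; lra.
have muY2 : mu <= mu * y ^+ 2 by rewrite ler_peMr // ltW.
have muY3 : mu * y ^+ 3 <= mu * y ^+ 4.
  by apply: ler_wpM2l; [exact: ltW | apply: ler_weXn2l].
have sq : (y ^+ 2 + 1) ^+ 2 = y ^+ 4 + 2 * y ^+ 2 + 1 by ring.
have t1 : #|[set G in labeled_graphs n |
    (1 + mu / 4) * y ^+ 4 <= #|b_isolated G|%:R]|%:R <= q ^+ j * W.
  by apply: tail (sum_b_isolated_le j) _ _ _; rewrite ?sq; lra.
have t2 : #|[set G in labeled_graphs n |
    mu / 12 * y ^+ 4 <= #|a_loops G|%:R]|%:R <= q ^+ j * W.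
  by apply: tail (sum_a_loops_le j) _ _ _; lra.
have t3 : #|[set G in labeled_graphs n |
    mu / 16 * y ^+ 4 <= #|b_loops G|%:R]|%:R <= q ^+ j * W.
  by apply: tail (sum_b_loops_le j) _ _ _; lra.
set A1 := [set G in _ | _] in t1; set A2 := [set G in _ | _] in t2.
set A3 := [set G in _ | _] in t3.
apply: (@le_trans _ _ (#|A1| + #|A2| + #|A3|)%N%:R); last by rewrite !natrD; lra.
rewrite ler_nat; apply: (@leq_trans #|A1 :|: A2 :|: A3|); last first.
  apply: leq_trans (leq_card_setU _ _) _; rewrite leq_add2r.
  exact: leq_card_setU.
apply/subset_leq_card/subsetP => G; rewrite in_setU in_setU !inE => /andP[-> big] /=.
rewrite -orbA; apply/or3P; move: big; rewrite /weight !natrD.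
have [b1|b1] := leP ((1 + mu / 4) * y ^+ 4) #|b_isolated G|%:R; first by constructor 1.
have [b2|b2] := leP (mu / 12 * y ^+ 4) #|a_loops G|%:R; first by constructor 2.
have [b3|b3] := leP (mu / 16 * y ^+ 4) #|b_loops G|%:R; first by constructor 3.
lra.
Qed.

End Tails.

From mathcomp Require Import all_classical all_reals all_analysis.

Import numFieldNormedType.Exports.
Local Open Scope classical_set_scope.
Local Open Scope ring_scope.

(** * Sixth roots and the rarity of disconnected pairs *)

Section SixthRoot.
Variable R : realType.

Definition root6 (n : nat) : R := n%:R `^ (1 / 6).

Lemma root6_ge0 n : 0 <= root6 n.
Proof. exact: powR_ge0. Qed.

Lemma root6X n k : root6 n ^+ k = n%:R `^ (k%:R / 6).
Proof. by rewrite -powR_mulrn ?root6_ge0 // /root6 -powRrM mul1r mulrC. Qed.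

Lemma root6K n : root6 n ^+ 6 = n%:R.
Proof. by rewrite root6X divff ?pnatr_eq0 // powRr1. Qed.

Lemma root6_ge1 n : (0 < n)%N -> 1 <= root6 n.
Proof.
move=> n0; rewrite -(@ler_pXn2r _ 6) ?nnegrE ?root6_ge0 //.
by rewrite expr1n root6K ler1n.
Qed.

Lemma root6_unbounded (M : R) : exists N, forall n, (N <= n)%N -> M <= root6 n.
Proof.
exists (Num.bound (Num.max M 0 ^+ 6)) => n Nn.
have M0 : 0 <= Num.max M 0 by rewrite le_max lexx orbT.
apply: (@le_trans _ _ (Num.max M 0)); first by rewrite le_max lexx.
rewrite -(@ler_pXn2r _ 6) ?nnegrE ?root6_ge0 // root6K.
apply: ltW; apply: lt_le_trans (archi_boundP _) _; first exact: exprn_ge0.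
by rewrite ler_nat.
Qed.

(** Division by n! turns the binomial convolution that counts splittings into an ordinary one. *)
Definition pair_density (n : nat) : R := (num_a n * num_b n)%N%:R / n`!%:R.
Notation u := pair_density.

Lemma pair_density_gt0 n : 0 < u n.
Proof. by rewrite divr_gt0 ?ltr0n ?muln_gt0 ?num_a_gt0 ?num_b_gt0 ?fact_gt0. Qed.

Lemma pair_density_ratio n :
  u n.+1 / u n = n.+1%:R / (tau R num_a n.+1 * tau R num_b n.+1).
Proof.
rewrite /u /tau factS !natrM succnK; field.
by rewrite !gt_eqF ?num_a_gt0R ?num_b_gt0R ?ltr0n ?fact_gt0.
Qed.

Lemma pair_density_ratio_ge n (y := root6 n.+1) : y - y^-1 <= u n.+1 / u n.
Proof.
have y1 : 1 <= y by apply: root6_ge1.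
have yK : n.+1%:R = y ^+ 6 by rewrite root6K.
clearbody y; have y0 : 0 < y by apply: lt_le_trans y1.
rewrite pair_density_ratio.
have ta : tau R num_a n.+1 <= y ^+ 3.
  by apply: tau_a_le; rewrite ?exprn_ge0 ?(ltW y0) // yK -exprM.
have tb : tau R num_b n.+1 <= y ^+ 2 + 1.
  by apply: tau_b_le; rewrite ?exprn_ege1 // yK -exprM.
have ta0 := @tau_a_gt0 R n.+1 isT; have tb0 := @tau_b_gt0 R n.+1 isT.
rewrite (ler_pdivlMr _ _ (mulr_gt0 ta0 tb0)).
have yV : 0 <= y - y^-1.
  by rewrite subr_ge0 (le_trans _ y1) // invf_le1.
apply: (@le_trans _ _ ((y - y^-1) * (y ^+ 3 * (y ^+ 2 + 1)))).
  by apply: ler_wpM2l => //; apply: ler_pM => //; apply: ltW.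
have -> : (y - y^-1) * (y ^+ 3 * (y ^+ 2 + 1)) = y ^+ 6 - y ^+ 2 by field; lra.
by rewrite yK lerBlDr lerDl exprn_ge0 // ltW.
Qed.

Lemma pair_density_ratio_le n (y := root6 n.+1) : u n.+1 / u n <= y + 17 / y.
Proof.
have y1 : 1 <= y by apply: root6_ge1.
have yK : n.+1%:R = y ^+ 6 by rewrite root6K.
clearbody y; have y0 : 0 < y by apply: lt_le_trans y1.
rewrite pair_density_ratio.
have ta : n.+1%:R / (1 + y ^+ 3) <= tau R num_a n.+1.
  by apply: tau_a_ge; rewrite ?exprn_ge0 ?(ltW y0) // yK -exprM.
have tb : n.+1%:R / (y ^+ 2 + 2) ^+ 2 <= tau R num_b n.+1.
  by apply: tau_b_ge; rewrite ?exprn_ege1 // yK -exprM.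
have ta0 := @tau_a_gt0 R n.+1 isT; have tb0 := @tau_b_gt0 R n.+1 isT.
have a0 : 0 < 1 + y ^+ 3 by rewrite ltr_pwDl // exprn_ge0 // ltW.
have b0 : 0 < (y ^+ 2 + 2) ^+ 2 by rewrite exprn_gt0 // ltr_wpDl // exprn_ge0 // ltW.
have yy : 0 < y + 17 / y by rewrite addr_gt0 // divr_gt0.
rewrite (ler_pdivrMr _ _ (mulr_gt0 ta0 tb0)) -ler_pdivrMl //.
have ta1 : 0 <= n.+1%:R / (1 + y ^+ 3) by rewrite divr_ge0 // ltW.
have tb1 : 0 <= n.+1%:R / (y ^+ 2 + 2) ^+ 2 by rewrite divr_ge0 // ltW.
apply: le_trans (ler_pM ta1 tb1 ta tb).
rewrite yK ler_pdivrMl //.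
have -> : (y + 17 / y) * (y ^+ 6 / (1 + y ^+ 3) * (y ^+ 6 / (y ^+ 2 + 2) ^+ 2)) =
   y ^+ 6 * (((y ^+ 7 + 17 * y ^+ 5)) / ((1 + y ^+ 3) * (y ^+ 2 + 2) ^+ 2)).
  by field; rewrite !gt_eqF // ltr_wpDl // exprn_ge0 // ltW.
rewrite -[leLHS]mulr1; apply: ler_wpM2l; first by rewrite exprn_ge0 // ltW.
rewrite (ler_pdivlMr _ _ (mulr_gt0 a0 b0)) mul1r.
have p k : (k <= 5)%N -> y ^+ k <= y ^+ 5 by move=> k5; apply: ler_weXn2l.
(* The constant 17 = 4 + 1 + 4 + 4 + 4 collects all coefficients below y^7, each power being at most
   y^5. *)
have -> : (1 + y ^+ 3) * (y ^+ 2 + 2) ^+ 2 =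
  y ^+ 7 + 4 * y ^+ 5 + y ^+ 4 + 4 * y ^+ 3 + 4 * y ^+ 2 + 4 * y ^+ 0 by ring.
have := p 4 isT; have := p 3 isT; have := p 2 isT; have := p 0 isT; lra.
Qed.

(* 1.12^6 < 2 *)
Lemma root6_double i m : (2 * i <= m)%N -> 112 / 100 * root6 i <= root6 m.
Proof.
move=> im; rewrite -(@ler_pXn2r _ 6) ?nnegrE ?mulr_ge0 ?root6_ge0 ?divr_ge0 //.
rewrite exprMn !root6K; apply: (@le_trans _ _ (2 * i%:R)); last first.
  by rewrite -natrM ler_nat.
by apply: ler_wpM2r => //; lra.
Qed.

Lemma disconnected_pairs_small (e : R) : 0 < e ->
  exists n0, forall n, (n0 <= n)%N ->
    (\sum_(1 <= k < n) 'C(n, k) *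
      (num_a k * num_b k * (num_a (n - k) * num_b (n - k))))%N%:R
    <= e * (num_a n * num_b n)%N%:R.
Proof.
move=> e0.
have [i0 Hi0] := root6_unbounded 50.
(* Doubling the index multiplies the sixth root by at least 1.12, and for y >= 50 one has y + 1 <=
   0.95 (1.12 y - 1); this is [r_le] with q = 0.95. *)
have [||||n0 Hn0] := @convolution_small R pair_density (95 / 100) i0.+1 _
    pair_density_gt0 _ _ _ e e0.
- by rewrite /u mul1n divff // oner_eq0.
- by lra.
- case=> // i [|m] // i0i im.
  apply: le_trans (pair_density_ratio_le i) _.
  apply: (@le_trans _ _ (95 / 100 * (root6 m.+1 - (root6 m.+1)^-1))); last first.
    by apply: ler_wpM2l; [lra | apply: pair_density_ratio_ge].
  have y50 := Hi0 i.+1 (leqW i0i).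
  have z := root6_double im.
  set y := root6 i.+1 in y50 z *; set x := root6 m.+1 in z *.
  have h1 : 17 / y <= 1 by rewrite ler_pdivrMr; lra.
  have h2 : x^-1 <= 1 by rewrite invf_le1; lra.
  lra.
- move=> M; have [N HN] := root6_unbounded (Num.max (M + 1) 1).
  exists N.+1 => -[//|n] Nn; apply: le_trans (pair_density_ratio_ge n).
  have := HN n.+1 (leqW Nn); rewrite ge_max => /andP[h1 h2].
  have : (root6 n.+1)^-1 <= 1 by rewrite invf_le1; lra.
  lra.
exists n0 => n /Hn0 H.
have nf : 0 < n`!%:R :> R by rewrite ltr0n fact_gt0.
have -> : (num_a n * num_b n)%N%:R = n`!%:R * u n by rewrite /u mulrC divfK // gt_eqF.
rewrite mulrCA; apply: le_trans (ler_wpM2l (ltW nf) H).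
rewrite natr_sum mulr_sumr le_eqVlt; apply/orP; left; apply/eqP.
(* Termwise, this is the identity 'C(n, k) k! (n-k)! = n!. *)
apply: eq_big_nat => k /andP[k0 kn].
rewrite /u -(bin_fact (ltnW kn)) !natrM; field.
by rewrite !gt_eqF ?ltr0n ?fact_gt0.
Qed.

End SixthRoot.

(** * Mean and tail of the silhouette size *)

Section Asymptotics.
Variable R : realType.
Notation W n := ((num_a n * num_b n)%N%:R : R).
Notation y := (root6 R).

Lemma root6_sqr n : y n ^+ 2 = n%:R `^ (1 / 3).
Proof. by rewrite root6X; congr (_ `^ _); field. Qed.

Lemma root6_pow4 n : y n ^+ 4 = n%:R `^ (2 / 3).
Proof. by rewrite root6X; congr (_ `^ _); field. Qed.

Lemma num_pairs_gt0 n : 0 < W n.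
Proof. by rewrite ltr0n muln_gt0 num_a_gt0 num_b_gt0. Qed.

Lemma card_labeled_graphs_ge (e : R) : 0 < e ->
  exists n0, forall n, (n0 <= n)%N -> (1 - e) * W n <= #|labeled_graphs n|%:R.
Proof.
move=> /disconnected_pairs_small[n0 H]; exists n0.+1 => -[//|n] n0n.
have := labeled_graphs_lower (ltn0Sn n); rewrite -(ler_nat R) natrD.
by have := H n.+1 (ltnW n0n); lra.
Qed.

Lemma mean_silh_size_ge n : (0 < n)%N -> 0 < #|labeled_graphs n|%:R :> R ->
  n%:R - (2 * (y n ^+ 2 + 1) ^+ 2 + 3 * y n ^+ 3 + 4 * (y n ^+ 2 + 1))
     * W n / #|labeled_graphs n|%:R <= mean_silh_size R n.
Proof.
move=> n0 L0; rewrite /mean_silh_size /unif_mean ler_pdivlMr // mulrBl divfK ?gt_eqF //.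
have := sum_weight_le (root6_ge1 R n0) (esym (root6K R n)).
have : (#|labeled_graphs n| * n <=
    \sum_(G in labeled_graphs n) silh_size G + \sum_(G in labeled_graphs n) weight G)%N.
  rewrite -sum_nat_const -big_split /=.
  by apply: leq_sum => G; apply: silh_size_weight.
rewrite -(ler_nat R) natrD natrM natr_sum mulrC; lra.
Qed.

Lemma mean_deficit_small (e : R) : 0 < e ->
  exists n0, forall n, (n0 <= n)%N ->
    n%:R - 2 * y n ^+ 4 - e * y n ^+ 4 <= mean_silh_size R n.
Proof.
(* This choice gives 3d + ed <= e, that is 2 + d <= (2 + e)(1 - d), which absorbs the loss from
   disconnected pairs. *)
move=> e0; pose d := Num.min (e / 8) (1 / 8).
have d0 : 0 < d by rewrite lt_min; apply/andP; split; lra.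
have de : d <= e / 8 by rewrite ge_min lexx.
have d1 : d <= 1 / 8 by rewrite ge_min lexx orbT.
have [n1 H1] := card_labeled_graphs_ge d0.
have [n2 H2] := root6_unbounded (17 / d).
exists (maxn n1 n2).+1 => n; rewrite gtn_max => /andP[n1n n2n].
have n0 : (0 < n)%N by apply: leq_ltn_trans n1n.
have {}H1 := H1 n (ltnW n1n); have {}H2 := H2 n (ltnW n2n).
have w0 := num_pairs_gt0 n; have y1 := root6_ge1 R n0.
have L0 : 0 < #|labeled_graphs n|%:R :> R.
  by apply: lt_le_trans H1; rewrite mulr_gt0 //; lra.
apply: le_trans (mean_silh_size_ge n0 L0).
set L := _%:R in L0 H1 *; set w := W n in w0 H1 *; set x := y n in y1 H2 *.
clearbody L w x.
(* The terms below x^4 in the mean bound are 3x^3 + 8x^2 + 6 <= 17 x^3, hence at most d x^4. *)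
have dx : 17 <= d * x by rewrite -ler_pdivrMl // mulrC.
have x3 : 17 * x ^+ 3 <= d * x ^+ 4.
  by rewrite (exprS _ 3) (mulrA d) ler_wpM2r // exprn_ge0 //; lra.
have x2 : x ^+ 2 <= x ^+ 3 by apply: ler_weXn2l.
have x0 : 1 <= x ^+ 2 by apply: exprn_ege1.
have x4 : 0 <= x ^+ 4 by rewrite exprn_ge0 //; lra.
have h1 : 2 * (x ^+ 2 + 1) ^+ 2 + 3 * x ^+ 3 + 4 * (x ^+ 2 + 1) <= (2 + d) * x ^+ 4.
  have -> : (x ^+ 2 + 1) ^+ 2 = x ^+ 4 + 2 * x ^+ 2 + 1 by ring.
  lra.
suff : (2 * (x ^+ 2 + 1) ^+ 2 + 3 * x ^+ 3 + 4 * (x ^+ 2 + 1)) * w / L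
    <= (2 + e) * x ^+ 4 by lra.
rewrite ler_pdivrMr //; apply: (@le_trans _ _ ((2 + d) * x ^+ 4 * w)).
  by apply: ler_wpM2r => //; apply: ltW.
apply: (@le_trans _ _ ((2 + e) * x ^+ 4 * ((1 - d) * w))); last first.
  by apply: ler_wpM2l => //; apply: mulr_ge0 => //; lra.
have -> : (2 + e) * x ^+ 4 * ((1 - d) * w) = (2 + e) * (1 - d) * x ^+ 4 * w by ring.
apply: ler_wpM2r; first exact: ltW.
by apply: ler_wpM2r => //; nra.
Qed.

(** The constant 6 is the 3 of the union bound times 2, since at least half of all pairs are
    connected for large [n]. *)
Lemma prob_silh_size_lt_small (mu : R) : 0 < mu ->
  exists n0, forall n, (n0 <= n)%N ->
    prob_silh_size_lt n (n%:R - (2 + mu) * n%:R `^ (2 / 3)) <=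
      6 * (1 + mu / 8)^-1 `^ (n%:R `^ (1 / 3)).
Proof.
move=> mu0; have half : 1 - 1 / 2 = 1 / 2 :> R by lra.
have large (s w a b : R) : s < a - b -> a <= s + w -> b < w by lra.
have [n1 H1] := card_labeled_graphs_ge (e := 1 / 2) ltac:(lra).
have [n2 H2] := root6_unbounded (500 * (1 + mu) / mu).
exists (maxn n1 n2).+1 => n; rewrite gtn_max => /andP[n1n n2n].
have n0 : (0 < n)%N by apply: leq_ltn_trans n1n.
have {}H1 := H1 n (ltnW n1n); have {}H2 := H2 n (ltnW n2n).
have w0 := num_pairs_gt0 n; have y1 := root6_ge1 R n0.
have L0 : 0 < #|labeled_graphs n|%:R :> R.
  by apply: lt_le_trans H1; rewrite mulr_gt0 //; lra.
have q0 : 0 < 1 + mu / 8 by rewrite addr_gt0 // divr_gt0.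
have q1 : 0 < (1 + mu / 8)^-1 <= 1.
  by rewrite invr_gt0 q0 invf_le1 // lerDl divr_ge0 // ltW.
have y2 : 0 <= y n ^+ 2 by rewrite exprn_ge0 // root6_ge0.
(* The order of the factorial moment is the least integer above n^(1/3). *)
pose j := (Num.truncn (y n ^+ 2)).+1.
have /andP[jle jge] := truncn_itv y2.
have jy : y n ^+ 2 <= j%:R <= y n ^+ 2 + 1.
  by rewrite ltW //= /j -natr1 lerD2r.
have ymu : 500 * (1 + mu) <= mu * y n by rewrite -ler_pdivrMl // mulrC.
have T := weight_tail y1 (esym (root6K R n)) mu0 jy ymu.
rewrite -root6_sqr -root6_pow4 /prob_silh_size_lt /unif_prob.
have qj : (1 + mu / 8)^-1 ^+ j <= (1 + mu / 8)^-1 `^ (y n ^+ 2).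
  have /andP[q1' _] := q1; rewrite -(powR_mulrn j (ltW q1')).
  by apply: ger_powR => //; case/andP: jy.
rewrite ler_pdivrMr //.
apply: (@le_trans _ _ (6 * (1 + mu / 8)^-1 ^+ j * (1 / 2 * W n))); last first.
  apply: ler_pM; rewrite ?mulr_ge0 ?exprn_ge0 ?invr_ge0 ?(ltW q0) ?(ltW w0) //.
    by rewrite ler_wpM2l.
  by rewrite -half.
apply: le_trans (le_trans T _); last first.
  by move: (_ ^+ j) (W n) => a b; rewrite le_eqVlt; apply/orP; left; apply/eqP; field.
rewrite ler_nat; apply/subset_leq_card/fintype.subsetP => G.
rewrite !inE => /andP[Glab small]; rewrite Glab /=.
have := silh_size_weight (n := n) (G := G); rewrite inE => /(_ Glab).
by rewrite -(ler_nat R) natrD; apply: large.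
Qed.

End Asymptotics.

Theorem proposition3p8 (R : realType) :
  (exists f : nat -> R,
     (f =o_\oo (fun n : nat => (n%:R : R) `^ (2 / 3))) /\
     (forall n : nat, (0 < n)%N ->
        n%:R - 2 * n%:R `^ (2 / 3) + f n < mean_silh_size R n)) /\
  (forall mu : R, 0 < mu ->
     exists gamma : R, 0 < gamma < 1 /\
       ((fun n : nat =>
           prob_silh_size_lt n (n%:R - (2 + mu) * n%:R `^ (2 / 3)))
        =O_\oo (fun n : nat => gamma `^ (n%:R `^ (1 / 3))))).
Proof.
split=> [|mu mu0]; last first.
  exists (1 + mu / 8)^-1; split.
    by rewrite invr_gt0 invf_lt1 ?addr_gt0 ?divr_gt0 // ltrDl divr_gt0.
  have [n0 H] := prob_silh_size_lt_small mu0.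
  apply/eqOP; exists 6; split=> [//|k k6]; exists n0 => // n /= n0n.
  have p0 : 0 <= prob_silh_size_lt n (n%:R - (2 + mu) * n%:R `^ (2 / 3)) :> R.
    by rewrite divr_ge0.
  rewrite ger0_norm // ger0_norm ?powR_ge0 //; apply: le_trans (H n n0n) _.
  by rewrite ler_wpM2r ?powR_ge0 // ltW.
(* The minimum with 0 makes the error term negative, so that only a lower bound on the mean is
   needed for the little-o; subtracting 1 makes the inequality strict for every [n]. *)
exists (fun n => Num.min 0 (mean_silh_size R n - n%:R + 2 * n%:R `^ (2 / 3)) - 1).
split; last first.
  move=> n _; rewrite -ltrBrDl ltrBlDr gt_min; apply/orP; right; lra.
apply/eqoP => eps eps0.
have [n1 H1] := mean_deficit_small (divr_gt0 eps0 (ltr0n R 2 : 0 < 2)).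

(* Half of [eps] bounds the deficit of the mean; the other half absorbs the subtracted 1 once y >= 2
   / eps, as y <= y^4. *)
have [n2 H2] := root6_unbounded (Num.max 1 (2 / eps)).
exists (maxn n1 n2) => // n /=; rewrite geq_max => /andP[n1n n2n].
have := H1 n n1n; have := H2 n n2n; rewrite -root6_pow4 ge_max => /andP[y1 y2].
set y := root6 R n in y1 y2 *; set m := mean_silh_size R n => h.
have y4 : y <= y ^+ 4 by rewrite -{1}(expr1 y) ler_weXn2l.
have e4 : 1 <= eps / 2 * y ^+ 4.
  rewrite -(@ler_pdivrMl _ (eps / 2)) ?divr_gt0 // mulr1 invf_div.
  exact: le_trans y2 y4.
have y40 : 0 <= y ^+ 4 by apply: le_trans y4; lra.
rewrite (ger0_norm y40) ler0_norm.
  rewrite opprB lerBlDr -lerBlDl le_min; apply/andP; split; lra.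
by rewrite subr_le0 ge_min; apply/orP; left; lra.
Qed.
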